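(* Equip $G=D_{\langle 2\rangle}([0,1])$ with either of its two Dlab orders. Then there exists an order automorphism $\alpha$ of $G$ such that, for every rank-one subgroup $H\le\mathbb R_{>0}^{\times}$, for every group $A$ among the six groups $$D_H(I),\quad D_{H*}(I),\quad D_{*H}(I),\quad \overline{D}_H(I),\quad D_H,\quad D_{H*},$$ equipped with any of its linear orders, for every order-preserving embedding $e:G\hookrightarrow A$, and for every $u\in A$, there exists $f\in G$ with $$e(\alpha(f))\neq u^{-1}e(f)u .$$
   Context: Group products are compositions of maps, $fg=f\circ g$. Linear orders on groups are total orders invariant under left and right multiplication. An order automorphism of an ordered group is a group automorphism preserving its specified linear order; an order-preserving embedding is an injective group homomorphism preserving the orders. $I=[0,1]$ and $\overline{\mathbb R}=\{-\infty\}\cup\mathbb R\cup\{+\infty\}$. A subgroup $H\le\mathbb R_{>0}^{\times}$ has rank one if it is nontrivial and any two of its elements are multiplicatively dependent (i.e. $H$ is torsion-free abelian of rank 1). For a subgroup $H\le\mathbb R_{>0}^{\times}$, an increasing homeomorphism $f$ of $I$ (resp. of $\overline{\mathbb R}$) is locally right $H$-linear if for every $x\in[0,1)$ (resp. every $x\in\mathbb R$) there are $k\in H$ and $\delta>0$ with $f(x+t)=f(x)+kt$ for $0\le t<\delta$; $k$ is the right slope of $f$ at $x$. Write $\operatorname{supp}(f)=\{x: f(x)\ne x\}$; a support component is a connected component of $\operatorname{supp}(f)$. On $I$: $\overline{D}_H(I)$ is the group of all increasing locally right $H$-linear homeomorphisms of $I$; $D_{H*}(I)$ is its subgroup of elements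 that are the identity near $0$; $D_{*H}(I)$ is its subgroup of elements that are the identity near $1$; $D_H(I)$ is its subgroup of elements that are the identity near both endpoints. On $\overline{\mathbb R}$: $D_H$ (resp. $D_{H*}$) is the group of increasing locally right $H$-linear homeomorphisms of $\overline{\mathbb R}$ with bounded support (resp. with support bounded below). $G=D_{\langle 2\rangle}([0,1])$ is the group $D_H(I)$ with $H=\langle 2\rangle=\{2^n:n\in\mathbb Z\}$. Every $1\ne f\in G$ has a leftmost support component; its left endpoint is the first breakpoint of $f$. The two Dlab orders on $G$ are: $f>1$ iff the right slope of $f$ at its first breakpoint is greater than $1$; and $f>1$ iff that slope is less than $1$. *)

(* Defs.v *)
From HB Require Import structures.
From mathcomp Require Import all_boot all_order all_algebra.
From mathcomp Require Import all_classical all_reals all_analysis.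
Import Order.TTheory GRing.Theory Num.Theory.
Import numFieldNormedType.Exports.

Set Implicit Arguments.
Unset Strict Implicit.
Unset Printing Implicit Defensive.

Local Open Scope classical_set_scope.
Local Open Scope ring_scope.

Section Homeo.
Context {d : Order.disp_t} {T : POrderedTopological.type d}.

Definition is_incr_homeo (f : T -> T) : Prop :=
  {mono f : x y / (x < y)%O} /\
  exists g : T -> T, [/\ cancel f g, cancel g f, continuous f & continuous g].

End Homeo.

Definition homeo d (T : POrderedTopological.type d) : Type :=
  {f : T -> T | `[< is_incr_homeo f >]}.

Definition homeo_fun d (T : POrderedTopological.type d) (f : homeo T) : T -> T :=
  sval f.
Coercion homeo_fun : homeo >-> Funclass.

Section HomeoGroup.
Context {d : Order.disp_t} {T : POrderedTopological.type d}.
Implicit Types f g h : homeo T.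

HB.instance Definition _ := Choice.copy (homeo T)
  {f : T -> T | `[< is_incr_homeo f >]}.

Lemma homeoP f : is_incr_homeo f.
Proof. by case: f => f /= /asboolP. Qed.

Lemma homeo_ext f g : f =1 g -> f = g.
Proof. by move=> fg; apply: val_inj; apply: funext. Qed.

Lemma is_incr_homeo_id : is_incr_homeo (@id T).
Proof. by split => //; exists id; split => // x; exact: cvg_id. Qed.

Lemma is_incr_homeo_comp (f g : T -> T) :
  is_incr_homeo f -> is_incr_homeo g -> is_incr_homeo (f \o g).
Proof.
move=> [mf [f' [ff' f'f cf cf']]] [mg [g' [gg' g'g cg cg']]]; split.
  by move=> x y /=; rewrite mf mg.
exists (g' \o f'); split; first exact: can_comp ff' gg'.
- exact: can_comp g'g f'f.
- by move=> x; apply: continuous_comp; [exact: cg|exact: cf].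
- by move=> x; apply: continuous_comp; [exact: cf'|exact: cg'].
Qed.

Definition homeo_inv_fun f : T -> T := sval (cid (proj2 (homeoP f))).

Lemma homeo_inv_funP f :
  [/\ cancel f (homeo_inv_fun f), cancel (homeo_inv_fun f) f,
      continuous f & continuous (homeo_inv_fun f)].
Proof. exact: svalP (cid (proj2 (homeoP f))). Qed.

Lemma is_incr_homeo_inv f : is_incr_homeo (homeo_inv_fun f).
Proof.
have [fg gf cf cg] := homeo_inv_funP f.
split; last by exists f; split.
by move=> x y; rewrite -(proj1 (homeoP f)) !gf.
Qed.

Definition homeo_one : homeo T := exist _ id (asboolT is_incr_homeo_id).
Definition homeo_mul f g : homeo T :=
  exist _ (f \o g) (asboolT (is_incr_homeo_comp (homeoP f) (homeoP g))).
Definition homeo_inv f : homeo T :=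
  exist _ (homeo_inv_fun f) (asboolT (is_incr_homeo_inv f)).

Fact homeo_mulA : associative homeo_mul.
Proof. by move=> f g h; apply: homeo_ext. Qed.
Fact homeo_mul1g : left_id homeo_one homeo_mul.
Proof. by move=> f; apply: homeo_ext. Qed.
Fact homeo_mulg1 : right_id homeo_one homeo_mul.
Proof. by move=> f; apply: homeo_ext. Qed.
Fact homeo_mulVg : left_inverse homeo_one homeo_inv homeo_mul.
Proof. by move=> f; apply: homeo_ext; have [] := homeo_inv_funP f. Qed.
Fact homeo_mulgV : right_inverse homeo_one homeo_inv homeo_mul.
Proof. by move=> f; apply: homeo_ext; have [] := homeo_inv_funP f. Qed.

HB.instance Definition _ := isGroup.Build (homeo T)
  homeo_mulA homeo_mul1g homeo_mulg1 homeo_mulVg homeo_mulgV.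

Lemma homeo1E x : (1%g : homeo T) x = x. Proof. by []. Qed.
Lemma homeoME f g x : ((f * g)%g : homeo T) x = f (g x). Proof. by []. Qed.
Lemma homeoK f : cancel f ((f^-1)%g : homeo T).
Proof. by have [] := homeo_inv_funP f. Qed.
Lemma homeoVK f : cancel ((f^-1)%g : homeo T) f.
Proof. by have [] := homeo_inv_funP f. Qed.
Lemma homeo_lt f : {mono f : x y / (x < y)%O}.
Proof. by have [] := homeoP f. Qed.
Lemma homeo_le f : {mono f : x y / (x <= y)%O}.
Proof. by move=> x y; rewrite !le_eqVlt homeo_lt (can_eq (homeoK f)). Qed.

End HomeoGroup.

Record subgroup (G : groupType) := Subgroup {
  subgroup_set :> set G ;
  subgroup_closed : group_closed (mem subgroup_set) }.

Definition subgroup_type (G : groupType) (K : subgroup G) : Type :=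
  {x : G | x \in (K : set G)}.

Section SubgroupType.
Context {G : groupType} (K : subgroup G).
HB.instance Definition _ := SubChoice.copy (subgroup_type K)
  {x : G | x \in (K : set G)}.
HB.instance Definition _ := SubChoice_isSubGroup.Build G
  (fun x => x \in (K : set G)) (subgroup_type K) (subgroup_closed K).
End SubgroupType.

Lemma group_closed_set (G : groupType) (S : set G) :
  S 1%g -> (forall x y, S x -> S y -> S (x * y)%g) ->
  (forall x, S x -> S (x^-1)%g) -> group_closed (mem S).
Proof.
move=> S1 SM SV; split; first exact: mem_set.
by move=> x y /set_mem Sx /set_mem Sy; apply: mem_set; apply: SM => //; exact: SV.
Qed.

Record pos_subgroup (R : realType) := PosSubgroup {
  pos_subgroup_set :> R -> Prop ;
  pos_subgroup_gt0 : forall k, pos_subgroup_set k -> 0 < k ;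
  pos_subgroup1 : pos_subgroup_set 1 ;
  pos_subgroupM : forall k l,
    pos_subgroup_set k -> pos_subgroup_set l -> pos_subgroup_set (k * l) ;
  pos_subgroupV : forall k, pos_subgroup_set k -> pos_subgroup_set k^-1 }.

Definition rank_one (R : realType) (H : pos_subgroup R) : Prop :=
  (exists2 k, H k & k != 1) /\
  (forall k l, H k -> H l ->
     exists m n : int, ((m, n) != (0, 0)) && (k ^ m * l ^ n == 1)).

Section Pow2.
Context (R : realType).

Definition pow2_set : set R := [set 2 ^ n | n in [set: int]].

Lemma pow2_gt0 k : pow2_set k -> 0 < k.
Proof. by case=> n _ <-; rewrite exprz_gt0. Qed.
Lemma pow2_1 : pow2_set 1.
Proof. by exists 0 => //; rewrite expr0z. Qed.
Lemma pow2_M k l : pow2_set k -> pow2_set l -> pow2_set (k * l).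
Proof. by case=> m _ <- [n _ <-]; exists (m + n) => //; rewrite expfzDr. Qed.
Lemma pow2_V k : pow2_set k -> pow2_set k^-1.
Proof. by case=> n _ <-; exists (- n) => //; rewrite -invr_expz. Qed.

Definition pow2 : pos_subgroup R := PosSubgroup pow2_gt0 pow2_1 pow2_M pow2_V.
End Pow2.

Definition unitI (R : realType) : Type := set_type `[(0 : R), 1].

Section UnitInterval.
Context {R : realType}.
HB.instance Definition _ := SubChoice.copy (unitI R) (set_type `[(0 : R), 1]).
HB.instance Definition _ := Topological.copy (unitI R) (set_type `[(0 : R), 1]).
HB.instance Definition _ := [Order of unitI R by <:].
End UnitInterval.

Definition supp (T : Type) (f : T -> T) : set T := [set x | f x <> x].

Section UnitIntervalGroups.
Context {R : realType}.
Implicit Types (f g : homeo (unitI R)) (x y : unitI R) (H : pos_subgroup R).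

Fact unitI0_subproof : (0 : R) \in [set` `[(0 : R), 1]].
Proof. by apply/mem_set; rewrite /= in_itv /= lexx ler01. Qed.
Fact unitI1_subproof : (1 : R) \in [set` `[(0 : R), 1]].
Proof. by apply/mem_set; rewrite /= in_itv /= lexx ler01. Qed.
Definition unitI0 : unitI R := exist _ 0 unitI0_subproof.
Definition unitI1 : unitI R := exist _ 1 unitI1_subproof.

(* f(x+t) = f(x) + kt for 0 <= t < delta and x+t in [0,1], with y = x+t. *)
Definition right_slopeI f x (k : R) : Prop :=
  exists2 delta : R, 0 < delta &
    forall y, val x <= val y < val x + delta ->
      val (f y) = val (f x) + k * (val y - val x).

Definition loc_right_linearI H : set (homeo (unitI R)) :=
  [set f | forall x, (x < unitI1)%O -> exists2 k, H k & right_slopeI f x k].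

Definition id_near x : set (homeo (unitI R)) :=
  [set f | \forall y \near x, f y = y].

Lemma unitI_ge0 x : 0 <= val x.
Proof. by have /set_mem := valP x; rewrite /= in_itv /= => /andP[]. Qed.
Lemma unitI_le1 x : val x <= 1.
Proof. by have /set_mem := valP x; rewrite /= in_itv /= => /andP[]. Qed.

Lemma homeoI_lt1 f x : (x < unitI1)%O -> (f x < unitI1)%O.
Proof.
move=> x1; apply: (@lt_le_trans _ _ (f unitI1)); first by rewrite homeo_lt.
exact: unitI_le1.
Qed.

Lemma right_slopeI1 x : right_slopeI (1%g : homeo (unitI R)) x 1.
Proof. by exists 1 => // y _; rewrite !homeo1E mul1r addrC subrK. Qed.

Lemma right_slopeIM f g x k l : 0 < l -> right_slopeI f (g x) k ->
  right_slopeI g x l -> right_slopeI (f * g)%g x (k * l).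
Proof.
move=> l0 [d1 d10 fk] [d2 d20 gl].
exists (Num.min d2 (d1 / l)); first by rewrite lt_min d20 divr_gt0.
move=> y /andP[xy]; rewrite -ltrBlDl lt_min => /andP[y2 y1].
have gy : val (g y) = val (g x) + l * (val y - val x).
  by apply: gl; rewrite xy -ltrBlDl.
rewrite !homeoME fk.
  by rewrite gy [X in X - _]addrC addrK mulrA.
rewrite gy lerDl mulr_ge0 ?subr_ge0 ?(ltW l0) //=.
by rewrite ltrD2l mulrC -ltr_pdivlMr.
Qed.

Lemma right_slopeIV f x k : 0 < k -> right_slopeI f x k ->
  right_slopeI (f^-1)%g (f x) k^-1.
Proof.
move=> k0 [e e0 fk].
set fV : homeo (unitI R) := (f^-1)%g.
have key y : val (f x) <= val y -> val (fV y) < val x + e ->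
    val (fV y) = val (fV (f x)) + k^-1 * (val y - val (f x)).
  move=> xy ye; rewrite homeoK -{2}(homeoVK f y) fk.
    by rewrite [X in _ * (X - _)]addrC addrK mulKf ?gt_eqF // addrC subrK.
  rewrite ye andbT; have : (x <= fV y)%O by rewrite -(homeo_le f) homeoVK.
  by [].
have [xe|xe] := ltP 1 (val x + e).
  exists 1 => // y /andP[xy _]; apply: key => //.
  exact: le_lt_trans (unitI_le1 _) xe.
have zP : val x + e \in [set` `[(0 : R), 1]].
  by apply/mem_set; rewrite /= in_itv /= xe addr_ge0 ?unitI_ge0 ?ltW.
pose z : unitI R := exist _ (val x + e) zP.
have xz : (x < z)%O by change (val x < val x + e); rewrite ltrDl.
exists (val (f z) - val (f x)).
  by rewrite subr_gt0; move: xz; rewrite -(homeo_lt f).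
move=> y; rewrite addrC subrK => /andP[xy yz]; apply: key => //.
suff : (fV y < z)%O by [].
by rewrite -(homeo_lt f) homeoVK.
Qed.

Lemma loc_right_linearI_closed H : group_closed (mem (loc_right_linearI H)).
Proof.
apply: group_closed_set.
- by move=> x _; exists 1; [exact: pos_subgroup1|exact: right_slopeI1].
- move=> f g lf lg x x1.
  have [k Hk fk] := lf _ (homeoI_lt1 g x1).
  have [l Hl gl] := lg _ x1.
  exists (k * l); first exact: pos_subgroupM.
  by apply: right_slopeIM fk gl; exact: pos_subgroup_gt0 Hl.
- move=> f lf x x1.
  have [k Hk fk] := lf _ (homeoI_lt1 (f^-1)%g x1).
  exists k^-1; first exact: pos_subgroupV.
  rewrite -{1}(homeoVK f x); apply: right_slopeIV fk.
  exact: pos_subgroup_gt0 Hk.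
Qed.

Lemma id_near_closed x : group_closed (mem (id_near x)).
Proof.
apply: group_closed_set.
- by apply: (@nearW _ (nbhs x)) => y; rewrite homeo1E.
- move=> f g; apply: filterS2 => y fy gy.
  by rewrite homeoME gy.
- by move=> f; apply: filterS => y fy; rewrite -{1}fy homeoK.
Qed.

End UnitIntervalGroups.

Section SubgroupI.
Context {G : groupType}.
Implicit Types K L : subgroup G.

Lemma setI_closed K L :
  group_closed (mem ((K : set G) `&` (L : set G))).
Proof.
have [K1 KF] := subgroup_closed K; have [L1 LF] := subgroup_closed L.
split=> [|x y]; first by apply/mem_set; split; exact: set_mem.
move=> /set_mem[/mem_set Kx /mem_set Lx] /set_mem[/mem_set Ky /mem_set Ly].
by apply/mem_set; split; apply: set_mem; [exact: KF|exact: LF].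
Qed.
Definition subgroupI K L : subgroup G := Subgroup (setI_closed K L).
End SubgroupI.

Section ExtendedLineGroups.
Context {R : realType}.
Implicit Types (f g : homeo (\bar R)) (x y : R) (H : pos_subgroup R).

Definition right_slopeE f x (k : R) : Prop :=
  exists2 delta : R, 0 < delta &
    forall t, 0 <= t < delta -> f (x + t)%:E = (f x%:E + (k * t)%:E)%E.

Definition loc_right_linearE H : set (homeo (\bar R)) :=
  [set f | forall x, exists2 k, H k & right_slopeE f x k].

Definition supp_bounded : set (homeo (\bar R)) :=
  [set f | exists M : R, supp f `<=` [set x | (- M%:E <= x <= M%:E)%E]].

Definition supp_bounded_below : set (homeo (\bar R)) :=
  [set f | exists m : R, supp f `<=` [set x | (m%:E <= x)%E]].

Lemma homeoE_fin f x : f x%:E \is a fin_num.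
Proof.
rewrite fin_real //; apply/andP; split.
  apply: (@le_lt_trans _ _ (f -oo%E)); first exact: leNye.
  by rewrite homeo_lt ltNyr.
apply: (@lt_le_trans _ _ (f +oo%E)); last exact: leey.
by rewrite homeo_lt ltry.
Qed.

Lemma homeoE_EFin f x : f x%:E = (fine (f x%:E))%:E.
Proof. by rewrite fineK // homeoE_fin. Qed.

Lemma right_slopeE1 x : right_slopeE (1%g : homeo (\bar R)) x 1.
Proof. by exists 1 => // t _; rewrite !homeo1E mul1r. Qed.

Lemma right_slopeEM f g x k l : 0 < l -> right_slopeE f (fine (g x%:E)) k ->
  right_slopeE g x l -> right_slopeE (f * g)%g x (k * l).
Proof.
move=> l0 [d1 d10 fk] [d2 d20 gl].
exists (Num.min d2 (d1 / l)); first by rewrite lt_min d20 divr_gt0.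
move=> t /andP[t0]; rewrite lt_min => /andP[t2 t1].
rewrite !homeoME gl ?t0 // homeoE_EFin -EFinD fk -?homeoE_EFin ?mulrA //.
by rewrite mulr_ge0 ?(ltW l0) //= mulrC -ltr_pdivlMr.
Qed.

Lemma right_slopeEV f x k : 0 < k -> right_slopeE f x k ->
  right_slopeE (f^-1)%g (fine (f x%:E)) k^-1.
Proof.
move=> k0 [e e0 fk]; exists (k * e); first exact: mulr_gt0.
move=> t /andP[t0 te]; set fV : homeo (\bar R) := (f^-1)%g.
have -> : (fine (f x%:E) + t)%:E = f (x + k^-1 * t)%:E.
  rewrite fk; first by rewrite EFinD -homeoE_EFin mulVKf ?gt_eqF.
  by rewrite mulr_ge0 ?invr_ge0 ?(ltW k0) //= ltr_pdivrMl.
by rewrite -homeoE_EFin !homeoK EFinD.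
Qed.

Lemma loc_right_linearE_closed H : group_closed (mem (loc_right_linearE H)).
Proof.
apply: group_closed_set.
- by move=> x; exists 1; [exact: pos_subgroup1|exact: right_slopeE1].
- move=> f g lf lg x.
  have [k Hk fk] := lf (fine ((g : homeo _) x%:E)).
  have [l Hl gl] := lg x.
  exists (k * l); first exact: pos_subgroupM.
  by apply: right_slopeEM fk gl; exact: pos_subgroup_gt0 Hl.
- move=> f lf x.
  have [k Hk fk] := lf (fine (((f^-1)%g : homeo _) x%:E)).
  exists k^-1; first exact: pos_subgroupV.
  have -> : x = fine ((f : homeo _) (fine (((f^-1)%g : homeo _) x%:E))%:E).
    by rewrite -homeoE_EFin homeoVK.
  by apply: right_slopeEV fk; exact: pos_subgroup_gt0 Hk.
Qed.

Lemma supp_boundedP f : supp_bounded f <->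
  exists M : R, forall y : \bar R, (y < - M%:E)%E \/ (M%:E < y)%E -> f y = y.
Proof.
split=> -[M fM]; exists M => y.
  move=> yM; apply: contrapT => /fM /andP[]; case: yM => yM.
    by rewrite leNgt yM.
  by rewrite (leNgt y) yM.
move=> fy; apply/andP; split; rewrite leNgt; apply/negP => yM; apply: fy.
  by apply: fM; left.
by apply: fM; right.
Qed.

Lemma supp_bounded_belowP f : supp_bounded_below f <->
  exists m : R, forall y : \bar R, (y < m%:E)%E -> f y = y.
Proof.
split=> -[m fm]; exists m => y.
  by move=> ym; apply: contrapT => /fm /=; rewrite leNgt ym.
by move=> fy /=; rewrite leNgt; apply/negP => ym; apply: fy; exact: fm.
Qed.

Lemma supp_bounded_closed : group_closed (mem supp_bounded).
Proof.
apply: group_closed_set => [|f g|f].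
- by apply/supp_boundedP; exists 0.
- move=> /supp_boundedP[M fM] /supp_boundedP[N gN]; apply/supp_boundedP.
  exists (Num.max M N) => y yMN; rewrite homeoME gN ?fM //.
    case: yMN => yMN; [left|right].
      by apply: lt_le_trans yMN _; rewrite leeN2 lee_fin le_max lexx.
    by apply: le_lt_trans yMN; rewrite lee_fin le_max lexx.
  case: yMN => yMN; [left|right].
    by apply: lt_le_trans yMN _; rewrite leeN2 lee_fin le_max lexx orbT.
  by apply: le_lt_trans yMN; rewrite lee_fin le_max lexx orbT.
- move=> /supp_boundedP[M fM]; apply/supp_boundedP; exists M => y /fM fy.
  by rewrite -{1}fy homeoK.
Qed.

Lemma supp_bounded_below_closed : group_closed (mem supp_bounded_below).
Proof.
apply: group_closed_set => [|f g|f].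
- by apply/supp_bounded_belowP; exists 0.
- move=> /supp_bounded_belowP[M fM] /supp_bounded_belowP[N gN].
  apply/supp_bounded_belowP; exists (Num.min M N) => y yMN.
  have yM : (y < M%:E)%E.
    by apply: lt_le_trans yMN _; rewrite lee_fin ge_min lexx.
  have yN : (y < N%:E)%E.
    by apply: lt_le_trans yMN _; rewrite lee_fin ge_min lexx orbT.
  by rewrite homeoME gN ?fM.
- move=> /supp_bounded_belowP[M fM]; apply/supp_bounded_belowP.
  by exists M => y /fM fy; rewrite -{1}fy homeoK.
Qed.

End ExtendedLineGroups.

Section DlabGroups.
Context {R : realType}.
Implicit Types H : pos_subgroup R.

Definition Dbar_I H : subgroup (homeo (unitI R)) :=
  Subgroup (loc_right_linearI_closed H).
Definition near0_I : subgroup (homeo (unitI R)) :=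
  Subgroup (id_near_closed unitI0).
Definition near1_I : subgroup (homeo (unitI R)) :=
  Subgroup (id_near_closed unitI1).
Definition DHstar_I H := subgroupI (Dbar_I H) near0_I.
Definition DstarH_I H := subgroupI (Dbar_I H) near1_I.
Definition D_I H := subgroupI (Dbar_I H) (subgroupI near0_I near1_I).

Definition Dbar_line H : subgroup (homeo (\bar R)) :=
  Subgroup (loc_right_linearE_closed H).
Definition D_line H :=
  subgroupI (Dbar_line H) (Subgroup supp_bounded_closed).
Definition DHstar_line H :=
  subgroupI (Dbar_line H) (Subgroup supp_bounded_below_closed).

End DlabGroups.

Inductive dlab_kind : Set :=
  | K_D_I | K_DHstar_I | K_DstarH_I | K_Dbar_I | K_D_line | K_DHstar_line.

Definition dlab_group (R : realType) (H : pos_subgroup R) (kd : dlab_kind) :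
    groupType :=
  match kd with
  | K_D_I => subgroup_type (D_I H)
  | K_DHstar_I => subgroup_type (DHstar_I H)
  | K_DstarH_I => subgroup_type (DstarH_I H)
  | K_Dbar_I => subgroup_type (Dbar_I H)
  | K_D_line => subgroup_type (D_line H)
  | K_DHstar_line => subgroup_type (DHstar_line H)
  end.

Section OrderedGroups.
Local Open Scope group_scope.

Definition linear_order (A : groupType) (le : rel A) : Prop :=
  [/\ reflexive le, antisymmetric le, transitive le, total le &
      forall x y z : A, le x y -> le (z * x) (z * y) /\ le (x * z) (y * z)].

Definition order_automorphism (A : groupType) (le : rel A) (alpha : A -> A) :
    Prop :=
  [/\ {morph alpha : x y / x * y}, bijective alpha &
      {mono alpha : x y / le x y}].

Definition order_embedding (A B : groupType) (leA : rel A) (leB : rel B)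
    (e : A -> B) : Prop :=
  [/\ {morph e : x y / x * y}, injective e &
      {homo e : x y / leA x y >-> leB x y}].

End OrderedGroups.

Section DlabOrder.
Context {R : realType}.
Implicit Types (f : homeo (unitI R)) (a : unitI R).

Definition support_component f (C : set (unitI R)) : Prop :=
  exists2 x, supp f x & C = connected_component (supp f) x.

Definition leftmost_component f (C : set (unitI R)) : Prop :=
  support_component f C /\
  forall C', support_component f C' -> C' <> C ->
    forall x y, C x -> C' y -> (x < y)%O.

Definition first_breakpoint f a : Prop :=
  exists2 C, leftmost_component f C & infimums C a.

(* Positivity for the two Dlab orders: initial slope greater than 1 when
   [up = true], initial slope less than 1 when [up = false]. *)
Definition dlab_pos (up : bool) f : Prop :=
  exists a k, [/\ first_breakpoint f a, right_slopeI f a k &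
    if up then 1 < k else k < 1].

Definition G2 (R : realType) : groupType := subgroup_type (D_I (pow2 R)).

Definition dlab_le (up : bool) : rel (G2 R) :=
  fun f g : G2 R => (f == g) ||
    `[< dlab_pos up (sval (f^-1 * g)%g) >].

End DlabOrder.

(* Main.v *)
Require Import Defs.
From mathcomp Require Import all_boot all_order all_algebra.
From mathcomp Require Import all_classical all_reals all_analysis.
From mathcomp Require Import lra ring zify.
Import Order.TTheory GRing.Theory Num.Theory.
Import numFieldNormedType.Exports.

Set Implicit Arguments.
Unset Strict Implicit.
Unset Printing Implicit Defensive.
Local Open Scope classical_set_scope.
Local Open Scope ring_scope.

(** The automorphism is [alpha f = phi^-1 * f * phi], where [phi] is an
increasing homeomorphism of [0,1] whose right slopes are all 3/4 or 3/2.  These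
slopes lie in a single coset of the powers of 2, so [phi] normalises [G]
([conj_in_G2]); and conjugation by a homeomorphism keeps the slope at the first
breakpoint, so the Dlab orders are preserved ([dlab_pos_conj]).  Moreover [phi]
fixes 1/2 with right slope 3/2.

Each of the six groups acts faithfully on the real line by increasing,
locally right [H]-linear bijections that are the identity near -oo (maps of the
interval are extended by the identity); this is [rl_action].  Let [E] be the
action of [G] on the line obtained from an embedding [e], and write [bp h] for
the first breakpoint of [E h].  The heart of the proof is that the points
[bp h] see the interval on which [G] lives: there is a strictly increasing,
right continuous map [transfer] from (0,1) to the line with
[transfer (g x) = E g (transfer x)] for [g] in [G].  It is defined by
[transfer x = inf bp h] over the [h != 1] which are the identity up to some
[x' > x].  If conjugation by [u] induced [alpha], the same definition would give
[transfer (phi x) = u (transfer x)] ([transfer_twist]).  Now compare germs on the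
right of 1/2 for [D t = transfer (1/2 + t) - transfer (1/2)].  An element of [G]
with slope 2 at its fixed point 1/2 gives [D (2 t) = l D t], and [phi] gives
[D (3/2 t) = m D t], with slopes [l] and [m] in [H].  As [H] has rank one,
[l ^ i * m ^ j = 1] for some [(i, j) != (0, 0)], whence [D (s t) = D t] for
[s = 2 ^ i * (3/2) ^ j]; strict monotonicity forces [s = 1], which is impossible.

That [transfer] is strictly increasing says that moving supports to the right
moves first breakpoints to the right.  Two facts are used.

- Slopes at a fixed point multiply in the abelian group [H], so the commutator of
  two elements commuting with [k] is trivial on the right of [bp k].  In [G]
  every element is a commutator of elements whose supports begin only slightly
  further to the left ([telescoping_product]), so everything supported to the right of [k] acts
  trivially on the right germ at [bp k] ([right_germ]).

- Let [z] push the support of [k] to the right of itself, and suppose that [E z]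
  does not move [p = bp k] to the right.  Then [p], [E z p], [E z (E z p)], ...
  decreases.  The infinite product [F] of the conjugates of [k] by the powers of
  [z] lies in [G], because breakpoints may accumulate from the left.  But [E F]
  has a slope different from 1 at every one of these points, and so it is not
  right linear at their limit ([shift_break]).

Finally any [h] supported to the right of [k] is the product of a conjugate of
[k] and a conjugate of [k^-1] by elements that push the support of [k] to the
right, which bounds [bp h] from below ([break_lt]). *)

(** * Right slopes of real functions *)

Section RightSlope.
Context {R : realType}.
Implicit Types (f g : R -> R) (x y k l : R).

Definition rslope f x k : Prop :=
  exists2 d : R, 0 < d & forall t : R, 0 <= t < d -> f (x + t) = f x + k * t.

Lemma rslope_uniq f x k l : rslope f x k -> rslope f x l -> k = l.
Proof.
move=> [d d0 fk] [e e0 fl].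
pose t : R := Num.min d e / 2.
have m0 : 0 < Num.min d e by rewrite lt_min d0.
have t0 : 0 < t by rewrite divr_gt0.
have /andP[td te] : (t < d) && (t < e).
  by rewrite -lt_min; rewrite /t; lra.
have := fk t; rewrite fl ?(ltW t0) ?td // => /(_ isT)/addrI/eqP.
by rewrite -subr_eq0 -mulrBl mulf_eq0 (gt_eqF t0) orbF subr_eq0 => /eqP.
Qed.

Lemma rslope_id x : rslope id x 1.
Proof. by exists 1 => // t _; rewrite mul1r. Qed.

Lemma rslope_comp f g x k l :
  0 <= l -> rslope f (g x) k -> rslope g x l -> rslope (f \o g) x (k * l).
Proof.
move=> l0 [d d0 fk] [e e0 gl].
exists (Num.min e (d / (l + 1))).
  by rewrite lt_min e0 divr_gt0 // ltr_wpDl.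
move=> t /andP[t0]; rewrite lt_min => /andP[te td] /=.
rewrite gl ?t0 // fk ?mulrA //; apply/andP; split; first exact: mulr_ge0.
move: td; rewrite ltr_pdivlMr ?ltr_wpDl // => td.
by apply: le_lt_trans td; rewrite mulrC ler_wpM2l // lerDl ler01.
Qed.

Lemma rslope_near f g x k c : x < c -> (forall y, x <= y < c -> f y = g y) ->
  rslope f x k -> rslope g x k.
Proof.
move=> xc fg [d d0 fk]; exists (Num.min d (c - x)).
  by rewrite lt_min d0 subr_gt0.
move=> t /andP[t0]; rewrite lt_min => /andP[td tc].
by rewrite -!fg ?lexx ?fk ?t0 // ?lerDl ?t0 //= -ltrBrDl.
Qed.

Lemma rslope_fix f x c : x < c -> (forall y, x <= y < c -> f y = y) ->
  rslope f x 1.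
Proof.
by move=> xc fx; apply: rslope_near xc _ (rslope_id x) => y /fx ->.
Qed.

Lemma rslope1_fix f x : f x = x -> rslope f x 1 ->
  exists2 d : R, 0 < d & forall y, x <= y < x + d -> f y = y.
Proof.
move=> fx [d d0 f1]; exists d => // y /andP[xy yd].
have := f1 (y - x); rewrite subr_ge0 xy ltrBlDl yd => /(_ isT).
by rewrite mul1r fx addrC subrK.
Qed.

Lemma rslope_affine f x c k y : (forall t : R, 0 <= t < c -> f (x + t) = f x + k * t) ->
  x <= y < x + c -> rslope f y k.
Proof.
move=> fk /andP[xy yc]; exists (x + c - y); first by rewrite subr_gt0.
move=> t /andP[t0 tc].
have -> : y + t = x + (y - x + t) by lra.
rewrite fk; last by apply/andP; split; lra.
have {2}-> : y = x + (y - x) by lra.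
rewrite fk; last by apply/andP; split; lra.
by lra.
Qed.

End RightSlope.

(** * Groups of locally right linear bijections of the line *)

(** The common frame for the six groups.  By [act_below] every nontrivial
element has a first breakpoint, and infinitely many fixed points of slope
different from 1 of one element cannot escape to -oo. *)
Record rl_action (R : realType) (H : pos_subgroup R) (A : groupType)
    (act : A -> R -> R) : Prop := RlAction {
  actM : forall f g x, act (f * g)%g x = act f (act g x) ;
  act_le : forall f, {mono act f : x y / x <= y} ;
  act_slope : forall f x, exists2 k, H k & rslope (act f) x k ;
  act_below : forall f, exists m, forall x, x < m -> act f x = x ;
  act_faithful : forall f, (forall x, act f x = x) -> f = 1%g }.

Section FixedParts.
Context {R : realType} {A : groupType} (act : A -> R -> R).

Definition fix_upto f p : Prop := forall x, x <= p -> act f x = x.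

Definition fix_outside f a b : Prop :=
  forall x, x <= a \/ b <= x -> act f x = x.

Definition first_break f p : Prop :=
  fix_upto f p /\ exists2 k, k != 1 & rslope (act f) p k.

Lemma fix_upto_le f p q : p <= q -> fix_upto f q -> fix_upto f p.
Proof. by move=> pq fq x xp; apply: fq; exact: le_trans pq. Qed.

End FixedParts.

Section RlAction.
Context {R : realType} {H : pos_subgroup R} {A : groupType}.
Context {act : A -> R -> R} (Pact : rl_action H act).
Implicit Types (f g h : A) (x y p q k l : R).

Lemma act_inj f : injective (act f).
Proof. exact: inc_inj (act_le Pact f). Qed.

Lemma act_lt f : {mono act f : x y / x < y}.
Proof. exact: leW_mono (act_le Pact f). Qed.

Lemma act1 x : act 1%g x = x.
Proof. by apply: (@act_inj 1%g); rewrite -(actM Pact) mulg1. Qed.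

Lemma actK f : cancel (act f) (act f^-1%g).
Proof. by move=> x; rewrite -(actM Pact) mulVg act1. Qed.

Lemma actVK f : cancel (act f^-1%g) (act f).
Proof. by move=> x; rewrite -(actM Pact) mulgV act1. Qed.

Lemma act_ext f g : act f =1 act g -> f = g.
Proof.
move=> fg; apply: (@mulIg _ g^-1%g); rewrite mulgV.
by apply: (act_faithful Pact) => x; rewrite (actM Pact) fg actVK.
Qed.

Lemma act_slope_gt0 f x k : rslope (act f) x k -> 0 < k.
Proof.
have [l Hl fl] := act_slope Pact f x.
by move=> /(rslope_uniq fl) <-; exact: pos_subgroup_gt0 Hl.
Qed.

Lemma act_slopeM f g x k l :
  rslope (act f) (act g x) k -> rslope (act g) x l ->
  rslope (act (f * g)%g) x (k * l).
Proof.
move=> fk gl; have -> : act (f * g)%g = act f \o act g.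
  by apply/funext => y; rewrite (actM Pact).
exact: rslope_comp (ltW (act_slope_gt0 gl)) fk gl.
Qed.

Lemma act_slopeV f x k : rslope (act f) x k ->
  rslope (act f^-1%g) (act f x) k^-1.
Proof.
move=> fk; have [l _ fl] := act_slope Pact f^-1%g (act f x).
suff <- : l = k^-1 by [].
have := act_slopeM fl fk; rewrite mulVg => lk.
have e1 : rslope (act 1%g) x 1 by apply: (@rslope_fix _ _ _ (x + 1)) => [|y _];
  rewrite ?act1 // ltrDl ltr01.
apply: (mulIf (lt0r_neq0 (act_slope_gt0 fk))); rewrite (rslope_uniq lk e1).
by rewrite mulVf // lt0r_neq0 // (act_slope_gt0 fk).
Qed.

Lemma fix_uptoM f g p : fix_upto act f p -> fix_upto act g p -> fix_upto act (f * g)%g p.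
Proof. by move=> fp gp x xp; rewrite (actM Pact) gp // fp. Qed.

Lemma fix_uptoV f p : fix_upto act f p -> fix_upto act f^-1%g p.
Proof. by move=> fp x xp; rewrite -{1}(fp x xp) actK. Qed.

Lemma fix_uptoJ f g p : fix_upto act f p -> fix_upto act (g * f * g^-1)%g (act g p).
Proof.
move=> fp x xp; rewrite !(actM Pact) fp ?actVK //.
by rewrite -(act_le Pact g) actVK.
Qed.

Lemma fix_upto_break f p q : first_break act f p -> fix_upto act f q -> q <= p.
Proof.
move=> [fp [k k1 fk]] fq; rewrite leNgt; apply/negP => pq.
move/eqP: k1; apply; apply: rslope_uniq fk _.
by apply: rslope_fix pq _ => y /andP[_ /ltW/fq].
Qed.

Lemma first_break_uniq f p q : first_break act f p -> first_break act f q -> p = q.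
Proof.
by move=> fp fq; apply/le_anti; rewrite (fix_upto_break fp (proj1 fq))
  (fix_upto_break fq (proj1 fp)).
Qed.

Lemma slopeJ f g p k : act f p = p -> rslope (act f) p k ->
  rslope (act (g * f * g^-1)%g) (act g p) k.
Proof.
move=> fp fk; have [l _ gl] := act_slope Pact g p.
have l0 := act_slope_gt0 gl.
have -> : k = l * k * l^-1 by rewrite mulrAC mulfV ?mul1r // lt0r_neq0.
apply: act_slopeM (act_slopeV gl); rewrite actK.
by apply: act_slopeM fk; rewrite fp.
Qed.

Lemma first_breakJ f g p : first_break act f p ->
  first_break act (g * f * g^-1)%g (act g p).
Proof.
move=> [fp [k k1 fk]]; split; first exact: fix_uptoJ.
by exists k => //; apply: slopeJ => //; exact: fp.
Qed.

(** With [p] the supremum of the points up to which [f] is the identity, right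
linearity at [p] makes a slope equal to 1 contradict maximality. *)
Lemma first_break_exists f : f != 1%g -> exists p, first_break act f p.
Proof.
move=> f1; have [y fy] : exists y, act f y != y.
  apply: contrapT => nf; move/eqP: f1; apply; apply: (act_faithful Pact) => y.
  by apply/eqP/negP => fy; apply: nf; exists y; apply/negP.
have [m fm] := act_below Pact f.
pose S : set R := [set x | fix_upto act f x].
have Sub : ubound S y.
  move=> x Sx; rewrite leNgt; apply/negP => yx.
  by move/eqP: fy; apply; apply: Sx; exact: ltW.
have Ssup : has_sup S.
  split; last by exists y.
  by exists (m - 1) => x xm; apply: fm; apply: le_lt_trans xm _; lra.
pose p := sup S.
have below z : z < p -> act f z = z.
  move=> zp.
  have [] := sup_adherent (_ : 0 < p - z) Ssup; first by rewrite subr_gt0.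
  by move=> w Sw; rewrite -/p subKr => zw; apply: Sw; exact: ltW.
have fpp : act f p = p.
  apply/le_anti/andP; split; rewrite leNgt; apply/negP => pf.
    pose w := act f^-1%g ((p + act f p) / 2).
    have fw : act f w = (p + act f p) / 2 by rewrite actVK.
    have wp : w < p by rewrite -(act_lt f) fw; lra.
    by move: fw; rewrite (below _ wp); lra.
  have := below _ pf => /act_inj e; by rewrite e ltxx in pf.
have fp : fix_upto act f p.
  by move=> x; rewrite le_eqVlt => /predU1P[->//|]; exact: below.
exists p; split=> //; have [k _ fk] := act_slope Pact f p; exists k => //.
apply/eqP => k1; rewrite {}k1 in fk.
have [d d0 fd] := rslope1_fix fpp fk.
have : S (p + d / 2).
  move=> x xd; have [xp|px] := leP x p; first exact: fp.
  by apply: fd; rewrite (ltW px) /=; lra.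
by move=> /(ub_le_sup (proj2 Ssup)); rewrite -/p; lra.
Qed.

(** Anything commuting with [f] fixes the first breakpoint of [f], and the right
slopes at a common fixed point form an abelian group. *)
Lemma commute_slope f c d p : first_break act f p ->
  commute f c -> commute f d ->
  act (c * d * c^-1 * d^-1)%g p = p /\
  rslope (act (c * d * c^-1 * d^-1)%g) p 1.
Proof.
move=> fp fc fd.
have fixp g : commute f g -> act g p = p.
  move=> fg; have := first_breakJ g fp.
  by rewrite -fg mulgK => /first_break_uniq; exact.
have [cp dp] := (fixp _ fc, fixp _ fd).
have cV : act c^-1%g p = p by rewrite -{1}cp actK.
have dV : act d^-1%g p = p by rewrite -{1}dp actK.
split; first by rewrite !(actM Pact) dV cV dp cp.
have [k _ ck] := act_slope Pact c p; have [l _ dl] := act_slope Pact d p.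
have k0 := lt0r_neq0 (act_slope_gt0 ck); have l0 := lt0r_neq0 (act_slope_gt0 dl).
have -> : 1 = k * l * k^-1 * l^-1 by rewrite mulrAC mulfK // mulfV.
have ckV := act_slopeV ck; have dlV := act_slopeV dl.
rewrite cp in ckV; rewrite dp in dlV.
apply: act_slopeM; last by [].
rewrite dV; apply: act_slopeM ckV; rewrite cV.
by apply: act_slopeM dl; rewrite dp.
Qed.

End RlAction.

(** * Locally right linear bijections *)

Section RlMap.
Context {R : realType}.
Implicit Types (f g : R -> R) (K : R -> Prop) (x y k l : R).

Record rl_map K f : Prop := RlMap {
  rl_le : {mono f : x y / x <= y} ;
  rl_surj : forall y, exists x, f x = y ;
  rl_slope : forall x, exists2 k, K k & rslope f x k }.

Lemma rl_affine K a b : 0 < a -> K a -> rl_map K (fun x => a * x + b).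
Proof.
move=> a0 Ka; split.
- by move=> x y; rewrite lerD2r ler_pM2l.
- by move=> y; exists (a^-1 * (y - b)); rewrite mulVKf ?gt_eqF // subrK.
- by move=> x; exists a => //; exists 1 => // t _; lra.
Qed.

Lemma rl_lt K f : rl_map K f -> {mono f : x y / x < y}.
Proof. by move=> /rl_le/leW_mono. Qed.

(** Two right linear germs at a point are comparable; this is what keeps the class
of locally right linear maps closed under maxima and minima, from which all the
explicit maps below are built. *)
Lemma rslope_cmp f g x k l : rslope f x k -> rslope g x l ->
  (exists2 c, x < c & forall y, x <= y < c -> f y <= g y) \/
  (exists2 c, x < c & forall y, x <= y < c -> g y <= f y).
Proof.
have lt f' g' k' l' : rslope f' x k' -> rslope g' x l' ->
    (f' x < g' x) || (f' x == g' x) && (k' <= l') ->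
    exists2 c, x < c & forall y, x <= y < c -> f' y <= g' y.
  move=> [d d0 fk] [e e0 gl] cmp.
  have [c [c0 cd ce cP]] : exists c : R, [/\ 0 < c, c <= d, c <= e &
      forall t, 0 <= t < c -> f' x + k' * t <= g' x + l' * t].
    case/orP: cmp => [fg|/andP[/eqP -> kl]]; last first.
      exists (Num.min d e).
      split=> [|||t /andP[t0 _]]; rewrite ?lt_min ?d0 // ?ge_min ?lexx ?orbT //.
      by rewrite lerD2l ler_wpM2r.
    pose q := (g' x - f' x) / (`|k' - l'| + 1).
    have n0 : 0 < `|k' - l'| + 1 by rewrite ltr_wpDl.
    exists (Num.min (Num.min d e) q); split.
    - by rewrite !lt_min d0 e0 divr_gt0 // subr_gt0.
    - by rewrite !ge_min lexx.
    - by rewrite !ge_min lexx !orbT.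
    move=> t /andP[t0]; rewrite lt_min => /andP[_]; rewrite ltr_pdivlMr // => tq.
    have : (k' - l') * t <= `|k' - l'| * t by rewrite ler_wpM2r // ler_norm.
    by nra.
  exists (x + c); first by rewrite ltrDl.
  move=> y /andP[xy yc]; have -> : y = x + (y - x) by lra.
  rewrite fk ?gl ?cP //; lra.
move=> fk gl; case: (ltgtP (f x) (g x)) => fg.
- by left; apply: lt fk gl _; rewrite fg.
- by right; apply: lt gl fk _; rewrite fg.
- have [kl|/ltW lk] := leP k l.
    by left; apply: lt fk gl _; rewrite fg eqxx kl orbT.
  by right; apply: lt gl fk _; rewrite fg eqxx lk orbT.
Qed.

Lemma rl_max K f g : rl_map K f -> rl_map K g ->
  rl_map K (fun x => Num.max (f x) (g x)).
Proof.
move=> Kf Kg; split.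
- apply: le_mono => x y xy.
  by rewrite gt_max !lt_max (rl_lt Kf) (rl_lt Kg) xy orbT.
- move=> y; have [x1 <-] := rl_surj Kf y; have [x2 gf] := rl_surj Kg (f x1).
  exists (Num.min x1 x2); have [x12|/ltW x21] := leP x1 x2.
    by apply/max_idPl; rewrite -gf (rl_le Kg).
  by rewrite -gf; apply/max_idPr; rewrite gf (rl_le Kf).
- move=> x; have [k Kk fk] := rl_slope Kf x; have [l Kl gl] := rl_slope Kg x.
  case: (rslope_cmp fk gl) => -[c xc cmp].
    exists l => //; apply: rslope_near xc _ gl => y /cmp fg.
    by apply/esym/max_idPr.
  exists k => //; apply: rslope_near xc _ fk => y /cmp fg.
  by apply/esym/max_idPl.
Qed.

Lemma rl_min K f g : rl_map K f -> rl_map K g ->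
  rl_map K (fun x => Num.min (f x) (g x)).
Proof.
move=> Kf Kg; split.
- apply: le_mono => x y xy.
  by rewrite lt_min !gt_min (rl_lt Kf) (rl_lt Kg) xy orbT.
- move=> y; have [x1 <-] := rl_surj Kf y; have [x2 gf] := rl_surj Kg (f x1).
  exists (Num.max x1 x2); have [x12|/ltW x21] := leP x1 x2.
    by rewrite -gf; apply/min_idPr; rewrite gf (rl_le Kf).
  by apply/min_idPl; rewrite -gf (rl_le Kg).
- move=> x; have [k Kk fk] := rl_slope Kf x; have [l Kl gl] := rl_slope Kg x.
  case: (rslope_cmp fk gl) => -[c xc cmp].
    exists k => //; apply: rslope_near xc _ fk => y /cmp fg.
    by apply/esym/min_idPl.
  exists l => //; apply: rslope_near xc _ gl => y /cmp fg.
  by apply/esym/min_idPr.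
Qed.

End RlMap.

(** * The dyadic group *)

(** What is used of [G]: it consists of all locally right linear bijections with
slopes powers of 2 and support bounded away from 0 and 1. *)
Record full_dyadic_action (R : realType) (G : groupType) (act : G -> R -> R) :
    Prop := FullDyadicAction {
  dyadic_act : rl_action (pow2 R) act ;
  dyadic_supp : forall f, exists a b,
    [/\ 0 < a, a < b, b < 1 & fix_outside act f a b] ;
  dyadic_full : forall F a b, rl_map (pow2 R) F -> 0 < a -> b < 1 ->
    (forall x, x <= a \/ b <= x -> F x = x) -> exists f, act f =1 F }.

Section Dyadic.
Context {R : realType} {G : groupType} {act : G -> R -> R}.
Context (Gact : full_dyadic_action act).
Let Pact : rl_action (pow2 R) act := dyadic_act Gact.
Implicit Types (f g h k z : G) (x y a b c d : R).

Lemma pow2Xn n : pow2 R (2 ^+ n).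
Proof. by exists (Posz n). Qed.

(** The homeomorphism of [c,e] with slope [2 ^ n] at [c] followed by slope
[2 ^ -n] up to [e], written so that it is the identity elsewhere. *)
Definition bump_fun c e n x : R :=
  Num.max x (Num.min (2 ^+ n * x + (c - 2 ^+ n * c))
                     ((2 ^+ n)^-1 * x + (e - (2 ^+ n)^-1 * e))).

Lemma bump_exists c e n : 0 < c -> c <= e -> e < 1 ->
  exists2 f, act f =1 bump_fun c e n & fix_outside act f c e.
Proof.
move=> c0 ce e1; have p0 : 0 < (2 : R) ^+ n by rewrite exprn_gt0.
have p1 : 1 <= (2 : R) ^+ n by rewrite exprn_ege1 // ler1n.
have q1 : ((2 : R) ^+ n)^-1 <= 1 by rewrite invf_le1.
have q0 : 0 < ((2 : R) ^+ n)^-1 by rewrite invr_gt0.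
have fixF x : x <= c \/ e <= x -> bump_fun c e n x = x.
  move=> xce; apply/max_idPl; rewrite ge_min.
  by case: xce => ?; apply/orP; [left|right]; nra.
have [|f fF] := dyadic_full Gact _ c0 e1 fixF.
  apply: rl_max.
    have -> : (fun x => x) = (fun x => 1 * x + 0) :> (R -> R).
      by apply/funext => x; rewrite mul1r addr0.
    by apply: rl_affine => //; exact: pow2_1.
  apply: rl_min; apply: rl_affine => //; first exact: pow2Xn.
  by apply: pow2_V; exact: pow2Xn.
by exists f => // x xo; rewrite fF fixF.
Qed.

Lemma push_exists c x y e : 0 < c -> c < x -> x < e -> y < e -> e < 1 ->
  exists2 f, y <= act f x & fix_outside act f c e.
Proof.
move=> c0 cx xe ye e1.
(* [2 ^ n >= B] puts both affine pieces of the bump above [y] at [x]. *)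
pose B := (e - c) / (x - c) + (e - x) / (e - y).
have B0 : 0 <= B.
  by rewrite addr_ge0 // divr_ge0 //; lra.
have [n nB] : exists n, B <= 2 ^+ n.
  exists (Num.bound B); apply: ltW; apply: lt_le_trans (archi_boundP B0) _.
  by rewrite -natrX ler_nat ltnW // ltn_expl.
have [f fF fo] := bump_exists n c0 (ltW (lt_trans cx xe)) e1.
exists f => //; rewrite fF le_max le_min; apply/orP; right.
have p0 : 0 < (2 : R) ^+ n by rewrite exprn_gt0.
have h1 : (e - c) / (x - c) <= 2 ^+ n.
  by apply: le_trans nB; rewrite lerDl divr_ge0 //; lra.
have h2 : (e - x) / (e - y) <= 2 ^+ n.
  by apply: le_trans nB; rewrite lerDr divr_ge0 //; lra.
rewrite ler_pdivrMr ?subr_gt0 // in h1.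
rewrite ler_pdivrMr ?subr_gt0 // -ler_pdivrMl // in h2.
by apply/andP; split; nra.
Qed.

Lemma act01 f : (forall x, x <= 0 -> act f x = x) /\ (forall x, 1 <= x -> act f x = x).
Proof.
have [a [b [a0 ab b1 fo]]] := dyadic_supp Gact f.
by split=> x xx; apply: fo; [left|right]; lra.
Qed.

Lemma act_lt1 f x : x < 1 -> act f x < 1.
Proof. by move=> x1; rewrite -[ltRHS](proj2 (act01 f)) // (act_lt Pact). Qed.

Lemma disjoint_commute f h b : (forall x, b <= x -> act f x = x) ->
  fix_upto act h b -> commute f h.
Proof.
move=> fb hb; apply: (act_ext Pact) => x; rewrite !(actM Pact).
have [xb|/ltW bx] := leP x b.
  by rewrite !hb // -[leRHS](fb b) // (act_le Pact).
by rewrite !fb // -[leLHS](hb b) // (act_le Pact).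
Qed.

(** The solution [F] is the infinite product of the conjugates of [h] by the
powers of [g].  Their supports move to the right and are pairwise disjoint, so
at each point the partial products [P n] are eventually constant; they may
accumulate only from the left of the limit of [g ^ n a], where right linearity
puts no condition.  The equation exhibits [h] as the commutator of [F] and
[g]. *)
Lemma telescoping_product g h a b : 0 < a -> b < 1 -> fix_outside act h a b ->
  a < b -> b <= act g a ->
  exists2 F, F = (h * (g * F * g^-1))%g & fix_upto act F a.
Proof.
move=> a0 b1 hab ab bga.
pose o n := iter n (act g) a.
pose P n : G := iter n (fun p => (h * (g * p * g^-1))%g) 1%g.
have oS n : o n.+1 = act g (o n) by [].
have PS n x : act (P n.+1) x = act h (act g (act (P n) (act g^-1%g x))).
  by rewrite !(actM Pact).
have o_lt n : o n < o n.+1.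
  elim: n => [|n IH]; first exact: lt_le_trans ab bga.
  by rewrite 2!oS (act_lt Pact).
have o_le : {homo o : m n / (m <= n)%N >-> m <= n}.
  by apply: homo_leq => [x|x y z|n]; [exact: lexx|exact: le_trans|exact: ltW].
have gV n x : x < o n -> act g^-1%g x < o n.
  move=> xn; rewrite -(act_lt Pact g) (actVK Pact) -oS.
  exact: lt_trans (o_lt n).
have gVS n x : (act g^-1%g x < o n) = (x < o n.+1).
  by rewrite -(act_lt Pact g) (actVK Pact).
have step n x : x < o n -> act (P n.+1) x = act (P n) x.
  elim: n x => [|n IH] x xn.
    by rewrite PS !(act1 Pact) (actVK Pact) hab //; left; exact: ltW.
  by rewrite PS [in RHS]PS IH // gVS.
have stable m n x : x < o m -> (m <= n)%N -> act (P n) x = act (P m) x.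
  move=> xm /subnK <-; elim: (n - m)%N => // j IH; rewrite addSn step //.
  by apply: lt_le_trans xm (o_le _ _ _); rewrite leq_addl.
have Pfix n x : x <= a -> act (P n) x = x.
  elim: n x => [|n IH] x xa; first by rewrite (act1 Pact).
  rewrite PS IH ?(actVK Pact); first by apply: hab; left.
  apply: le_trans (_ : act g^-1%g a <= a); first by rewrite (act_le Pact).
  by apply: ltW; rewrite -[ltRHS]/(o 0%N) gVS; exact: (o_lt 0%N).
have Po n : act (P n) (o n) = o n.
  elim: n => [|n IH]; first by rewrite (act1 Pact).
  rewrite PS oS (actK Pact) IH; apply: hab; right; apply: le_trans bga _.
  by rewrite (act_le Pact); exact: (o_le 0%N).
have Plt n x : (act (P n) x < o n) = (x < o n).
  by rewrite -{1}(Po n) (act_lt Pact).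
(* On the points beyond every [o n] all partial products are the identity. *)
pose good x := exists n, x < o n.
pose F x := if pselect (good x) is left gx then act (P (projT1 (cid gx))) x else x.
have Fgood n x : x < o n -> F x = act (P n) x.
  move=> xn; rewrite /F; case: pselect => [gx|]; last by case; exists n.
  case: (cid gx) => m xm /=; case/orP: (leq_total m n) => mn.
    by rewrite (stable m n).
  by rewrite (stable n m).
have Fbad x : ~ good x -> F x = x by rewrite /F; case: pselect.
have Flt : {homo F : x y / x < y}.
  move=> x y xy; have [[n yn]|by'] := pselect (good y).
    by rewrite !(Fgood n) // ?(act_lt Pact) //; exact: lt_trans yn.
  rewrite (Fbad y) //; have [[n xn]|bx] := pselect (good x); last by rewrite Fbad.
  rewrite (Fgood n) //; have : o n <= y.
    by rewrite leNgt; apply/negP => yn; apply: by'; exists n.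
  by apply: lt_le_trans; rewrite Plt.
have [c [c0 c1 ac gc]] : exists c, [/\ 0 < c, c < 1, a < c & act g c = c].
  have [a' [c [a'0 a'c c1 gc]]] := dyadic_supp Gact g.
  have cm : Num.max c b < 1 by rewrite gt_max c1.
  exists (Num.max c b); split=> //; rewrite ?lt_max ?ab ?orbT //.
    by apply/orP; left; lra.
  by apply: gc; right; rewrite le_max lexx.
have oc n : o n < c by elim: n => // n IH; rewrite oS -gc (act_lt Pact).
have Ffix x : x <= a \/ c <= x -> F x = x.
  case=> [xa|cx]; first by rewrite (Fgood 1%N) ?Pfix // (le_lt_trans xa (o_lt 0%N)).
  by apply: Fbad => -[n]; rewrite ltNge (le_trans (ltW (oc n))).
have [|f fF] := dyadic_full Gact _ a0 c1 Ffix.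
  split; first exact: le_mono.
    move=> y; have [[n yn]|ngy] := pselect (good y); last by exists y; exact: Fbad.
    exists (act (P n)^-1%g y); rewrite (Fgood n) ?(actVK Pact) //.
    by rewrite -Plt (actVK Pact).
  move=> x; have [[n xn]|ngx] := pselect (good x).
    have [k Hk Pk] := act_slope Pact (P n) x; exists k => //.
    by apply: rslope_near xn _ Pk => y /andP[_ yn]; rewrite (Fgood n).
  exists 1; first exact: pow2_1.
  apply: (@rslope_fix _ _ _ (x + 1)); first by rewrite ltrDl.
  move=> y /andP[xy _]; apply: Fbad => -[n yn]; apply: ngx; exists n.
  exact: le_lt_trans yn.
exists f; last by move=> x xa; rewrite fF; apply: Ffix; left.
apply: (act_ext Pact) => x; rewrite !(actM Pact) !fF.
have [[n xn]|ngx] := pselect (good x).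
  have xS : x < o n.+1 by exact: lt_trans (o_lt n).
  by rewrite (Fgood n.+1) // PS (Fgood n) // gVS.
have ngg : ~ good (act g^-1%g x) by move=> [n]; rewrite gVS => xn; apply: ngx; exists n.+1.
rewrite !Fbad // (actVK Pact); apply/esym/hab; right.
by apply: le_trans bga _; rewrite leNgt; apply/negP => xg; apply: ngx; exists 1%N.
Qed.

End Dyadic.

(** * Infima under monotone bijections, and powers of 2 and 3 *)

Lemma inf_image_mono (R : realType) (U : R -> R) (S : set R) :
  {mono U : x y / x <= y} -> (forall y, exists x, U x = y) -> has_inf S ->
  inf (U @` S) = U (inf S).
Proof.
move=> Ule Usurj [[s0 Ss0] Slb]; have lbS : has_lbound S by [].
apply/le_anti/andP; split.
  have [v Uv] := Usurj (inf (U @` S)); rewrite -Uv Ule.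
  apply: lb_le_inf; first by exists s0.
  move=> s Ss; rewrite -Ule Uv; apply: ge_inf; last by exists s.
  case: Slb => l Sl; exists (U l) => _ [r Sr <-]; rewrite Ule; exact: Sl.
apply: lb_le_inf; first by exists (U s0), s0.
by move=> _ [s Ss <-]; rewrite Ule; apply: ge_inf.
Qed.

Lemma pow3_pow2 (R : realType) (n j : int) :
  (3 : R) ^ n = 2 ^ j -> n = 0 /\ j = 0.
Proof.
have nat_case (m : nat) (i : int) : (3 : R) ^ (Posz m) = 2 ^ i -> m = 0%N /\ i = 0.
  case: i => [i|i] e.
    have : (3 ^ m = 2 ^ i)%N by apply/eqP; rewrite -(eqr_nat R) !natrX; apply/eqP; exact: e.
    move=> {}e; case: i e => [|i] e; last by move: (congr1 odd e); rewrite !oddX /= orbT.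
    by case: m e => // m; rewrite expn0 expnS => /eqP; rewrite muln_eq1.
  have : (2 : R) ^ (Negz i) < 1.
    by rewrite NegzE -exprnN invf_lt1 ?exprn_gt0 // exprn_egt1 // ltr1n.
  by rewrite -e ltNge exprn_ege1 // ler1n.
case: n => [n|n]; first by move=> /nat_case[-> ->].
move=> e; have := nat_case n.+1 (- j); rewrite -[X in _ = X -> _]invrK invr_expz opprK -e.
by rewrite NegzE -exprnN invrK => /(_ erefl)[].
Qed.

(** * First breakpoints under an embedding *)

Section Breakpoints.
Context {R : realType} {G : groupType} {gam : G -> R -> R}.
Context (Gact : full_dyadic_action gam).
Context {H : pos_subgroup R} {E : G -> R -> R} (PE : rl_action H E).
Let Pact : rl_action (pow2 R) gam := dyadic_act Gact.
Implicit Types (f g h k z : G) (x y a b c d p q w : R).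

Lemma telescoped_commutator F g h :
  F = (h * (g * F * g^-1))%g -> h = (F * g * F^-1 * g^-1)%g.
Proof. by move=> {1}->; rewrite !mulgA mulgVK mulgK mulgK. Qed.

Lemma fix_outside_upto h y : fix_upto gam h y -> y < 1 ->
  exists2 B, y < B < 1 & fix_outside gam h y B.
Proof.
move=> hy y1; have [a0 [b0 [_ _ b1 hab]]] := dyadic_supp Gact h.
exists ((Num.max b0 y + 1) / 2).
  have : Num.max b0 y < 1 by rewrite gt_max b1.
  have : y <= Num.max b0 y by rewrite le_max lexx orbT.
  by move=> ? ?; apply/andP; split; lra.
move=> x [xy|Bx]; [exact: hy|apply: hab; right].
have : Num.max b0 y < 1 by rewrite gt_max b1.
have : b0 <= Num.max b0 y by rewrite le_max lexx.
lra.
Qed.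

(** Write [h] as a commutator of elements that are the identity up to [b]: both
of them commute with [f]. *)
Lemma right_germ f h p b y : first_break E f p ->
  (forall x, b <= x -> gam f x = x) -> fix_upto gam h y ->
  0 < b -> b < y -> y < 1 -> E h p = p /\ rslope (E h) p 1.
Proof.
move=> fp fb hy b0 by' y1.
have [B /andP[yB B1] hB] := fix_outside_upto hy y1.
have [g gB go] : exists2 g, B <= gam g y & fix_outside gam g b ((B + 1) / 2).
  by apply: (push_exists Gact); lra.
have [F FE Fy] := telescoping_product Gact (lt_trans b0 by') B1 hB yB gB.
rewrite (telescoped_commutator FE).
apply: (commute_slope PE fp).
  exact: (disjoint_commute Gact fb (fix_upto_le (ltW by') Fy)).
apply: (disjoint_commute Gact fb) => x xb.
by apply: go; left.
Qed.

(** Otherwise the points [q n] obtained from [p] by iterating [E z] decrease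
strictly ([E z p = p] is excluded by [right_germ]).  For [F = k * (z F z^-1)], the
second factor acts trivially on the germ at [p], so [E F] inherits the slope of
[E k] at [p]; conjugating by [z] carries this from [q n] to [q n.+1], where [E k]
is trivial.  A map with slope different from 1 at each of its fixed points [q n]
is not right linear at their infimum. *)
Lemma shift_break k z a b p : fix_outside gam k a b -> 0 < a -> a < b ->
  b < gam z a -> first_break E k p -> p < E z p.
Proof.
move=> kab a0 ab bz kp; have [kfix [k0 k01 kk0]] := kp.
have za1 : gam z a < 1.
  apply: (act_lt1 Gact); rewrite ltNge; apply/negP => a1.
  have := proj2 (act01 Gact z) a a1; lra.
have [F FE Fa] := telescoping_product Gact a0 (lt_trans bz za1) kab ab (ltW bz).
have kb x : b <= x -> gam k x = x by move=> bx; apply: kab; right.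
have kJ : fix_upto gam (z * k * z^-1)%g (gam z a).
  by apply: (fix_uptoJ Pact) => x xa; apply: kab; left.
have b0 := lt_trans a0 ab.
rewrite ltNge; apply/negP => zple.
have zp : E z p < p.
  rewrite lt_neqAle zple andbT; apply/eqP => zp.
  have [_ [l l1]] := first_breakJ PE z kp; rewrite zp => zk.
  have [_ k1] := right_germ kp kb kJ b0 bz za1.
  by move/eqP: l1; apply; apply: rslope_uniq zk k1.
have [F1p F1s] := right_germ kp kb (fix_uptoJ Pact (g := z) Fa) b0 bz za1.
pose q n := iter n (E z) p.
have q_lt n : q n.+1 < q n.
  by elim: n => // n IH; rewrite /q 2!iterS (act_lt PE).
have q_le m n : (m <= n)%N -> q n <= q m.
  by move=> /subnK<-; elim: (n - m)%N => // j IH; exact: le_trans (ltW (q_lt _)) IH.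
have Fq n : E F (q n) = q n /\ rslope (E F) (q n) k0.
  elim: n => [|n [Fq Fs]].
    rewrite FE; split; first by rewrite (actM PE) F1p kfix.
    by rewrite -[k0]mulr1; apply: (act_slopeM PE) F1s; rewrite F1p.
  have zFq : E (z * F * z^-1)%g (q n.+1) = q n.+1.
    by rewrite /q iterS !(actM PE) (actK PE) Fq.
  have qp : q n.+1 < p by apply: lt_le_trans (q_lt n) (q_le 0%N n (leq0n n)).
  rewrite FE; split; first by rewrite (actM PE) zFq kfix // ltW.
  rewrite -[k0]mul1r; apply: (act_slopeM PE); last exact: (slopeJ PE).
  by rewrite zFq; apply: rslope_fix qp _ => x /andP[_ /ltW]; exact: kfix.
have [m Fm] := act_below PE F.
have mq n : m <= q n.
  rewrite leNgt; apply/negP => qm; move/eqP: k01; apply.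
  apply: rslope_uniq (proj2 (Fq n)) _.
  by apply: rslope_fix qm _ => x /andP[_]; exact: Fm.
pose Q : set R := range q.
have Qinf : has_inf Q.
  split; first by exists (q 0%N), 0%N.
  by exists m => _ [n _ <-].
pose r := inf Q.
have rq n : r <= q n by apply: ge_inf; [case: Qinf|exists n].
have [l _ [d d0 Fl]] := act_slope PE F r.
have [_ [n _ <-] qn] := inf_adherent d0 Qinf.
have aff i : (n <= i)%N -> q i = E F r + l * (q i - r) /\ rslope (E F) (q i) l.
  move=> ni; have qi : r <= q i < r + d by rewrite rq (le_lt_trans (q_le _ _ ni)).
  split; last exact: rslope_affine Fl qi.
  rewrite -Fl; first by rewrite addrC subrK (proj1 (Fq i)).
  by rewrite subr_ge0 ltrBlDl.
have [e1 s1] := aff n (leqnn n); have [e2 _] := aff n.+1 (leqnSn n).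
have : (l - 1) * (q n - q n.+1) = 0 by lra.
move/eqP; rewrite mulf_eq0 [X in _ || X]gt_eqF ?subr_gt0 // orbF subr_eq0 => /eqP l1.
move/eqP: k01; apply; rewrite -l1; exact: rslope_uniq (proj2 (Fq n)) s1.
Qed.

(** An element [z] of [G] is built that moves the support of [k] to the right of
[b], and so far that the conjugate [g = z k z^-1] pushes [y] beyond the support of
[h].  Then [h = (F g F^-1) g^-1] for a telescoping product [F] which is the
identity up to [y], and [shift_break] applies to [z] and to [F z]. *)
Lemma break_lt k w a b p h q y : fix_outside gam k a b -> 0 < a -> a < b ->
  w < gam k w -> first_break E k p -> first_break E h q -> fix_upto gam h y ->
  b < y -> y < 1 -> p < q.
Proof.
move=> kab a0 ab wk kp hq hy by' y1.
have aw : a < w.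
  by rewrite ltNge; apply/negP => wa; move: wk; rewrite kab ?ltxx //; left.
have [B /andP[yB B1] hB] := fix_outside_upto hy y1.
have w1 : w < 1.
  rewrite ltNge; apply/negP => w1; move: wk.
  by rewrite (proj2 (act01 Gact k)) // ltxx.
pose c := (b + y) / 2; pose c' := (c + y) / 2; pose e := (B + 1) / 2.
have [bc cc' c'y Be e1] : [/\ b < c, c < c', c' < y, B < e & e < 1].
  by rewrite /c' /c /e; split; lra.
(* [z1] carries [a] beyond [c]; the inverse of [z2] pulls [w] back below [c']
   without undoing this; [z3] spreads [gam k w] beyond [B]. *)
have [z1 z1a _] : exists2 z, c <= gam z a & fix_outside gam z (a / 2) e.
  by apply: (push_exists Gact); lra.
pose w1' := gam z1 w.
have w1'1 : w1' < 1 by exact: (act_lt1 Gact).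
have [z2 z2c' z2o] : exists2 z, w1' <= gam z c' &
    fix_outside gam z c (Num.max ((1 + w1') / 2) e).
  have me : (1 + w1') / 2 <= Num.max ((1 + w1') / 2) e by rewrite le_max lexx.
  have ee : e <= Num.max ((1 + w1') / 2) e by rewrite le_max lexx orbT.
  apply: (push_exists Gact) => //; try lra.
  by rewrite gt_max e1 andbT; lra.
pose v := gam z2^-1%g w1'.
have vc' : v <= c' by rewrite -(act_le Pact z2) (actVK Pact).
have cz2 : c <= gam z2^-1%g (gam z1 a).
  rewrite -[leLHS](fix_uptoV Pact (fun x xc => z2o x (or_introl xc)) (lexx c)).
  by rewrite (act_le Pact).
have cv : c < v.
  apply: le_lt_trans cz2 _; by rewrite 2!(act_lt Pact).
pose v' := gam z2^-1%g (gam z1 (gam k w)).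
have vv' : v < v' by rewrite 2!(act_lt Pact).
have v'1 : v' < 1 by do 3!apply: (act_lt1 Gact).
have [z3 z3v' z3o] : exists2 z, B <= gam z v' &
    fix_outside gam z v (Num.max ((1 + v') / 2) e).
  have me : (1 + v') / 2 <= Num.max ((1 + v') / 2) e by rewrite le_max lexx.
  have ee : e <= Num.max ((1 + v') / 2) e by rewrite le_max lexx orbT.
  apply: (push_exists Gact) => //; try lra.
  by rewrite gt_max e1 andbT; lra.
pose z := (z3 * z2^-1 * z1)%g.
have z3v : fix_upto gam z3 v by move=> x xv; apply: z3o; left.
have za : c <= gam z a.
  rewrite !(actM Pact); apply: le_trans (_ : gam z3 c <= _).
    by rewrite z3v // ltW.
  by rewrite (act_le Pact).
have zw : gam z w <= y.
  by rewrite !(actM Pact) z3v ?lexx // ltW // (le_lt_trans vc').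
have zkw : B <= gam z (gam k w) by rewrite !(actM Pact).
clearbody z; have gy : B <= gam (z * k * z^-1)%g y.
  apply: le_trans zkw _; rewrite !(actM Pact) 2!(act_le Pact).
  by rewrite -(act_le Pact z) (actVK Pact).
have y0 : 0 < y by lra.
have [F FE Fy] := telescoping_product Gact y0 B1 hB yB gy.
rewrite ltNge; apply/negP => qp.
have sz : p < E z p by apply: (shift_break kab a0 ab _ kp); lra.
have sFz : p < E (F * z)%g p.
  apply: (shift_break kab a0 ab _ kp); rewrite (actM Pact).
  apply: lt_le_trans bc _; rewrite -[leLHS]Fy; last by lra.
  by rewrite (act_le Pact).
have [kfix _] := kp.
have fix_min : fix_upto E h (Num.min (E z p) (E (F * z)%g p)).
  rewrite (telescoped_commutator FE) -!mulgA.
  have -> : (F * (z * (k * (z^-1 * (F^-1 * (z * (k * z^-1))^-1)))))%g =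
            ((F * z) * k * (F * z)^-1 * (z * k * z^-1)^-1)%g.
    by rewrite !invgM !mulgA.
  apply: (fix_uptoM PE).
    by apply: fix_upto_le (fix_uptoJ PE (g := (F * z)%g) kfix); rewrite ge_min lexx orbT.
  by apply: fix_upto_le (fix_uptoV PE (fix_uptoJ PE (g := z) kfix)); rewrite ge_min lexx.
have := fix_upto_break hq fix_min; rewrite ge_min => /orP[]; lra.
Qed.

End Breakpoints.

(** * The map induced on breakpoints *)

Section Transfer.
Context {R : realType} {G : groupType} {gam : G -> R -> R}.
Context (Gact : full_dyadic_action gam).
Context {H : pos_subgroup R} {E : G -> R -> R} (PE : rl_action H E).
Let Pact : rl_action (pow2 R) gam := dyadic_act Gact.
Implicit Types (f g h k z : G) (x y a b c d p q w s t : R).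

Definition breaks_after x : set R :=
  [set p | exists f x', [/\ x < x', first_break E f p & fix_upto gam f x']].

(** Taking the infimum over elements that are the identity up to some point
strictly beyond [x] makes [transfer] right continuous by construction. *)
Definition transfer x : R := inf (breaks_after x).

Lemma pusher_exists x y : 0 <= x -> x < y -> y < 1 -> exists k w a b p,
  [/\ [/\ x < a, a < b & b < y], fix_outside gam k a b, w < gam k w &
      first_break E k p].
Proof.
move=> x0 xy y1; pose d := (y - x) / 5.
have [k kw ko] : exists2 k, x + 3 * d <= gam k (x + 2 * d) &
    fix_outside gam k (x + d) (x + 4 * d).
  by apply: (push_exists Gact); rewrite /d; lra.
have wk : x + 2 * d < gam k (x + 2 * d).
  by apply: lt_le_trans kw; rewrite /d; lra.
have [p kp] : exists p, first_break E k p.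
  apply: (first_break_exists PE); apply/eqP => k1.
  by move: wk; rewrite k1 (act1 Pact) ltxx.
exists k, (x + 2 * d), (x + d), (x + 4 * d), p; split=> //.
by rewrite /d; split; lra.
Qed.

Lemma breaks_after_has_inf x : 0 < x -> x < 1 -> has_inf (breaks_after x).
Proof.
move=> x0 x1; split.
  have [|||k [w [a [b [p [[xa ab b1] ko _ kp]]]]]] :=
    @pusher_exists x ((x + 1) / 2); try lra.
  by exists p, k, a; split=> // u ua; apply: ko; left.
have [|||k [w [a [b [p [[xa ab bx] ko wk kp]]]]]] := @pusher_exists 0 x; try lra.
exists p => q [f [x' [xx' fq fx]]]; apply/ltW.
by apply: (break_lt Gact PE ko xa ab wk kp fq (fix_upto_le (ltW xx') fx)).
Qed.

Lemma transfer_lt x y : 0 < x -> x < y -> y < 1 -> transfer x < transfer y.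
Proof.
move=> x0 xy y1.
have [|||k [w [a [b [p [[xa ab bm] ko wk kp]]]]]] :=
  @pusher_exists x ((x + y) / 2); try lra.
have [|||k' [w' [a' [b' [p' [[xa' ab' bm'] ko' wk' kp']]]]]] :=
  @pusher_exists ((x + y) / 2) y; try lra.
have xp : transfer x <= p.
  apply: ge_inf; first by case: (breaks_after_has_inf x0 (lt_trans xy y1)).
  by exists k, a; split=> // u ua; apply: ko; left.
have pp' : p < p'.
  apply: (break_lt Gact PE ko _ ab wk kp kp' (y := a')); try lra.
  by move=> u ua; apply: ko'; left.
have p'y : p' <= transfer y.
  apply: lb_le_inf; first by case: (breaks_after_has_inf (lt_trans x0 xy) y1).
  move=> q [f [x' [xx' fq fx]]]; apply/ltW.
  apply: (break_lt Gact PE ko' _ ab' wk' kp' fq (fix_upto_le (ltW xx') fx)) => //.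
  by lra.
exact: le_lt_trans xp (lt_le_trans pp' p'y).
Qed.

Lemma transfer_right_cont x e : 0 < x -> x < 1 -> 0 < e ->
  exists2 d : R, 0 < d & forall t, 0 <= t < d -> transfer (x + t) < transfer x + e.
Proof.
move=> x0 x1 e0; have xinf := breaks_after_has_inf x0 x1.
have [p [f [x' [xx' fp fx]]] pe] := inf_adherent e0 xinf.
exists (Num.min (x' - x) (1 - x)); first by rewrite lt_min !subr_gt0 xx'.
move=> t /andP[t0]; rewrite lt_min => /andP[tx' t1].
apply: le_lt_trans pe; apply: ge_inf.
  by apply: (proj2 (breaks_after_has_inf _ _)); lra.
by exists f, x'; split=> //; lra.
Qed.

(** Equivariance is needed for elements [g] of [G], with [theta] the action of
[g] and [U = E g], and for [phi] with [U = u].  In both cases a surjection [tau] of [G]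
is induced by [theta] on the interval and by [U] on the line. *)
Section Twist.
Context (tau : G -> G) (theta U : R -> R) (K : R -> Prop).
Context (tau_surj : forall f, exists f', tau f' = f).
Context (theta_le : {mono theta : x y / x <= y}).
Context (theta_surj : forall y, exists x, theta x = y).
Context (U_rl : rl_map K U) (K_gt0 : forall l : R, K l -> 0 < l).
Context (theta_tau : forall f x, theta (gam (tau f) x) = gam f (theta x)).
Context (U_tau : forall f x, U (E (tau f) x) = E f (U x)).

Lemma first_break_twist f p : first_break E (tau f) p <-> first_break E f (U p).
Proof.
have Uinj := inc_inj (rl_le U_rl).
have UEq : U \o E (tau f) = E f \o U by apply/funext => x; exact: U_tau.
have [l Kl Ul] := rl_slope U_rl p; have l0 := K_gt0 Kl.
have [k _ fk] := act_slope PE (tau f) p; have [m _ fm] := act_slope PE f (U p).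
have fixE : fix_upto E (tau f) p <-> fix_upto E f (U p).
  split=> fp x xp.
    have [w wx] := rl_surj U_rl x.
    by rewrite -wx -U_tau fp // -(rl_le U_rl) wx.
  by apply: Uinj; rewrite U_tau fp // (rl_le U_rl).
have km : E (tau f) p = p -> k = m.
  move=> fp; have s1 : rslope (U \o E (tau f)) p (l * k).
    by apply: (rslope_comp (ltW (act_slope_gt0 PE fk)) _ fk); rewrite fp.
  have s2 := rslope_comp (ltW l0) fm Ul.
  rewrite UEq in s1; have := rslope_uniq s1 s2; rewrite [RHS]mulrC.
  exact/mulfI/lt0r_neq0.
split=> -[/[dup] fp /fixE fp' [i i1 fi]]; split=> //; exists i => //.
  by rewrite (rslope_uniq fi fk) (km (fp _ (lexx _))).
by rewrite (rslope_uniq fi fm) -(km (fp' _ (lexx _))).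
Qed.

Lemma fix_upto_twist f x :
  fix_upto gam (tau f) x <-> fix_upto gam f (theta x).
Proof.
split=> fx y yx.
  have [w wy] := theta_surj y.
  by rewrite -wy -theta_tau fx // -theta_le wy.
by apply: (inc_inj theta_le); rewrite theta_tau fx // theta_le.
Qed.

Lemma transfer_twist x : 0 < x -> x < 1 ->
  transfer (theta x) = U (transfer x).
Proof.
move=> x0 x1; rewrite /transfer.
rewrite -(inf_image_mono (rl_le U_rl) (rl_surj U_rl) (breaks_after_has_inf x0 x1)).
congr inf; apply/seteqP; split=> [q|_ [p [f' [x' [xx' fp fx]]] <-]].
  move=> [f [y' [xy' fq fy]]].
  have [p Up] := rl_surj U_rl q; have [x' xy] := theta_surj y'.
  exists p => //; exists (tau f), x'; split.
  - by rewrite -(leW_mono theta_le) xy.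
  - by apply/first_break_twist; rewrite Up.
  - by apply/fix_upto_twist; rewrite xy.
have [f fE] := tau_surj f'; rewrite -{}fE in fp fx.
exists f, (theta x'); split.
- by rewrite (leW_mono theta_le).
- exact/first_break_twist.
- exact/fix_upto_twist.
Qed.

End Twist.

Definition increment x t : R := transfer (x + t) - transfer x.

(** The germ of [transfer] on the right of [x] is homogeneous for the factor [s]
with multiplier [k]. *)
Definition scales x s (k : R) : Prop :=
  exists2 d : R, 0 < d & forall t, 0 <= t < d -> increment x (s * t) = k * increment x t.

Lemma scalesM x s (k : R) s' (k' : R) : 0 < s' -> scales x s k -> scales x s' k' ->
  scales x (s * s') (k * k').
Proof.
move=> s'0 [d d0 sk] [d' d'0 sk'].
exists (Num.min d' (d / s')); first by rewrite lt_min d'0 divr_gt0.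
move=> t /andP[t0]; rewrite lt_min ltr_pdivlMr // => /andP[td' td].
rewrite -!mulrA sk; last by rewrite mulr_ge0 ?(ltW s'0) //= mulrC.
by rewrite sk' ?t0 // mulrA.
Qed.

Lemma scales1 x : scales x 1 1.
Proof. by exists 1 => // t _; rewrite !mul1r. Qed.

Lemma scalesV x s (k : R) : 0 < s -> k != 0 -> scales x s k -> scales x s^-1 k^-1.
Proof.
move=> s0 k0 [d d0 sk]; exists (s * d); first exact: mulr_gt0.
move=> t /andP[t0 td]; rewrite -[in RHS](mulVKf (lt0r_neq0 s0) t) sk ?mulKf //.
by rewrite mulr_ge0 ?invr_ge0 ?(ltW s0) //= ltr_pdivrMl.
Qed.

Lemma scalesX x s (k : R) n : 0 < s -> scales x s k -> scales x (s ^+ n) (k ^+ n).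
Proof.
move=> s0 sk; elim: n => [|n IH]; first exact: scales1.
by rewrite !exprS; apply: scalesM => //; exact: exprn_gt0.
Qed.

Lemma scalesXz x s (k : R) (n : int) : 0 < s -> k != 0 -> scales x s k ->
  scales x (s ^ n) (k ^ n).
Proof.
move=> s0 k0 sk; case: n => n; first exact: scalesX.
rewrite NegzE -!exprnN; apply: scalesV; rewrite ?exprn_gt0 ?expf_neq0 //.
exact: scalesX.
Qed.

Lemma scales_eq1 x s : 0 < x -> x < 1 -> 0 < s -> scales x s 1 -> s = 1.
Proof.
move=> x0 x1 s0 [d d0 s1]; pose m : R := Num.min d ((1 - x) / (s + 1)).
have m0 : 0 < m by rewrite lt_min d0 divr_gt0 // ?subr_gt0 // ltr_wpDr.
pose t : R := m / 2; have t0 : 0 < t by rewrite divr_gt0.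
have tm : t < m by rewrite /t; lra.
have /andP[td] : (t < d) && (t < (1 - x) / (s + 1)) by rewrite -lt_min.
rewrite ltr_pdivlMr ?addr_gt0 // => tx; clear tm; clearbody t; clear m m0.
have := s1 t; rewrite (ltW t0) td mul1r => /(_ isT)/addIr e.
have st0 : 0 < s * t by exact: mulr_gt0.
have : s * t = t.
  apply: contrapT => /eqP; rewrite neq_lt => /orP[] st.
    have : transfer (x + s * t) < transfer (x + t).
      by apply: transfer_lt; [exact: addr_gt0|rewrite ltrD2l|lra].
    by rewrite e ltxx.
  have : transfer (x + t) < transfer (x + s * t).
    by apply: transfer_lt; [exact: addr_gt0|rewrite ltrD2l|lra].
  by rewrite e ltxx.
by rewrite -{2}[t]mul1r => /(mulIf (lt0r_neq0 t0)).
Qed.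

Lemma scales_twist (theta U : R -> R) x s (k : R) : 0 < x -> x < 1 ->
  (forall y, 0 < y -> y < 1 -> transfer (theta y) = U (transfer y)) ->
  theta x = x -> rslope theta x s -> rslope U (transfer x) k -> scales x s k.
Proof.
move=> x0 x1 tw fx [d d0 sl] [e e0 Uk].
have [c c0 cont] := transfer_right_cont x0 x1 e0.
exists (Num.min (Num.min c d) (1 - x)); first by rewrite !lt_min c0 d0 subr_gt0.
move=> t /andP[t0]; rewrite !lt_min => /andP[/andP[tc td] t1].
have Ux : U (transfer x) = transfer x by rewrite -tw // fx.
rewrite /increment -{1}fx -sl ?t0 // tw; [|lra|lra].
have -> : transfer (x + t) = transfer x + increment x t.
  by rewrite /increment [RHS]addrC subrK.
rewrite Uk ?Ux; first by rewrite /increment; lra.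
rewrite /increment subr_ge0 ltrBlDl cont ?t0 // andbT.
have [->|tn0] := eqVneq t 0; first by rewrite addr0.
by apply/ltW/transfer_lt => //; lra.
Qed.

(** Both 2 and 3/2 scale the germ of [transfer] at 1/2 by elements of [H]; a
multiplicative relation between the multipliers would be one between 2 and 3/2. *)
Lemma no_rank_one_conjugation (alpha : G -> G) (phi U : R -> R) :
  rank_one H ->
  (forall f, exists f', alpha f' = f) ->
  {mono phi : x y / x <= y} -> (forall y, exists x, phi x = y) ->
  phi (1 / 2) = 1 / 2 -> rslope phi (1 / 2) (3 / 2) ->
  rl_map H U ->
  (forall f x, phi (gam (alpha f) x) = gam f (phi x)) ->
  ~ (forall f x, U (E (alpha f) x) = E f (U x)).
Proof.
move=> [_ H1] asurj phile phisurj phi2 phis Url phia Ua.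
have h0 : 0 < 1 / 2 :> R by lra.
have h1 : 1 / 2 < 1 :> R by lra.
pose B := transfer (1 / 2).
have [h Hh Uh] := rl_slope Url B.
have H0 : forall k : R, H k -> 0 < k := @pos_subgroup_gt0 _ H.
have s32 : scales (1 / 2) (3 / 2) h.
  apply: (scales_twist h0 h1 _ phi2 phis Uh) => y y0 y1.
  exact: (transfer_twist asurj phile phisurj Url H0 phia Ua).
have [g gE _] : exists2 g, gam g =1 bump_fun (1 / 2) (3 / 4) 1 &
    fix_outside gam g (1 / 2) (3 / 4) by apply: (bump_exists Gact); lra.
have [l Hl gl] := act_slope PE g B.
have s2 : scales (1 / 2) 2 l.
  apply: (scales_twist h0 h1 _ _ _ gl) => [y y0 y1||].
  - apply: (@transfer_twist (fun f => g^-1 * f * g)%g (gam g) (E g) H) => //.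
    + by move=> f; exists (g * f * g^-1)%g; rewrite !mulgA mulVg mul1g mulgVK.
    + exact: (act_le Pact).
    + by move=> z; exists (gam g^-1%g z); rewrite (actVK Pact).
    + split; [exact: (act_le PE)| |exact: (act_slope PE)].
      by move=> z; exists (E g^-1%g z); rewrite (actVK PE).
    + by move=> f z; rewrite !(actM Pact) (actVK Pact).
    + by move=> f z; rewrite !(actM PE) (actVK PE).
  - rewrite gE /bump_fun expr1; apply/max_idPl; rewrite ge_min.
    by apply/orP; left; lra.
  - exists (1 / 12); first lra.
    move=> t /andP[t0 t1]; rewrite !gE /bump_fun expr1.
    rewrite (min_idPl _) ?(max_idPr _) ?(min_idPl _) ?(max_idPl _); lra.
have [m [n /andP[mn /eqP lh]]] := H1 _ _ Hl Hh.
have l0 := lt0r_neq0 (H0 _ Hl); have hn0 := lt0r_neq0 (H0 _ Hh).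
have p2 : 0 < (2 : R) by lra.
have p32 : 0 < 3 / 2 :> R by lra.
have := scalesM (exprz_gt0 n p32) (scalesXz m p2 l0 s2) (scalesXz n p32 hn0 s32).
rewrite lh => /(scales_eq1 h0 h1) e.
have {}e : 2 ^ m * (3 / 2) ^ n = 1 :> R by apply: e; rewrite mulr_gt0 // exprz_gt0.
have e3 : (3 : R) ^ n = 2 ^ (n - m).
  have -> : (3 : R) ^ n = (3 / 2) ^ n * 2 ^ n.
    by rewrite -expfzMl; congr (_ ^ _); lra.
  have m0 : (2 : R) ^ m != 0 by rewrite lt0r_neq0 // exprz_gt0.
  by rewrite -[(3 / 2) ^ n](mulKf m0) e mulr1 invr_expz -expfzDr ?lt0r_neq0 // addrC.
have [n0 nm0] := pow3_pow2 e3.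
by move/eqP: mn; apply; rewrite n0 in nm0 *; congr (_, _); lia.
Qed.

End Transfer.

(** * Maps of the interval extended to the line *)

Section UnitI.
Context {R : realType}.
Implicit Types (f g : homeo (unitI R)) (y z : unitI R) (x : R).

Lemma clampI_subproof x : Num.max 0 (Num.min x 1) \in [set` `[(0 : R), 1]].
Proof.
apply/mem_set; rewrite /= in_itv /= le_max lexx /= ge_max ler01 /=.
by rewrite ge_min lexx orbT.
Qed.

Definition clampI x : unitI R := 
  exist (fun r : R => r \in [set` `[(0 : R), 1]]) _ (clampI_subproof x).

Lemma val_clampI x : 0 <= x <= 1 -> val (clampI x) = x.
Proof. by move=> /andP[x0 x1] /=; rewrite (min_idPl x1) (max_idPr x0). Qed.

Lemma unitI_itv y : 0 <= val y <= 1.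
Proof. by rewrite unitI_ge0 unitI_le1. Qed.

Lemma clampIK y : clampI (val y) = y.
Proof. by apply/val_inj/val_clampI/unitI_itv. Qed.

Lemma val_lt y z : (val y < val z) = (y < z)%O.
Proof. by []. Qed.

Lemma val_le y z : (val y <= val z) = (y <= z)%O.
Proof. by []. Qed.

Lemma val_continuous : continuous (val : unitI R -> R).
Proof. exact: initial_continuous. Qed.

Lemma unitI_nbhs y (U : set (unitI R)) : nbhs y U ->
  exists2 e : R, 0 < e & forall z, `|val y - val z| < e -> U z.
Proof.
rewrite nbhsE => -[B [[A oA <-] Ay] BU].
have : nbhs (val y : R) A by apply: open_nbhs_nbhs; split.
move=> /nbhs_ballP[e /= e0 eA]; exists e => // z yz.
by apply: BU; apply: eA.
Qed.

Lemma to_unitI_continuous (T : topologicalType) (h : T -> unitI R) :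
  continuous (val \o h) -> continuous h.
Proof.
move=> hc x U; rewrite nbhsE => -[B [[A oA <-] Ay] BU].
have : nbhs (val (h x) : R) A by apply: open_nbhs_nbhs; split.
move=> /(hc x) hx; change (nbhs x (h @^-1` U)).
by apply: filterS (hx : nbhs x ((val \o h) @^-1` A)) => t At; exact: BU.
Qed.

Lemma clampI_continuous : continuous clampI.
Proof.
apply: to_unitI_continuous => x.
apply: (@continuous_max _ _ (fun=> 0) (fun t : R => Num.min t 1)).
  exact: cvg_cst.
by apply: (@continuous_min _ _ id (fun=> 1)); [exact: cvg_id|exact: cvg_cst].
Qed.

Definition extI f x : R := if 0 <= x <= 1 then val (f (clampI x)) else x.

Lemma extI_in f y : extI f (val y) = val (f y).
Proof. by rewrite /extI unitI_itv clampIK. Qed.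

Lemma extI_out f x : ~~ (0 <= x <= 1) -> extI f x = x.
Proof. by rewrite /extI => /negPf ->. Qed.

Variant unitI_spec x : Type :=
  | UnitIIn y of x = val y : unitI_spec x
  | UnitIOut of ~~ (0 <= x <= 1) : unitI_spec x.

Lemma unitIP x : unitI_spec x.
Proof.
have [x01|x01] := boolP (0 <= x <= 1); last exact: UnitIOut.
by apply: (UnitIIn (y := clampI x)); rewrite val_clampI.
Qed.

Lemma extIM f g x : extI (f * g)%g x = extI f (extI g x).
Proof. by have [y ->|xo] := unitIP x; rewrite ?extI_in // !extI_out. Qed.

Lemma extI_le f : {mono extI f : x y / x <= y}.
Proof.
apply: le_mono => x1 x2 x12; have [y1 e1|o1] := unitIP x1;
  have [y2 e2|o2] := unitIP x2.
- by rewrite e1 e2 !extI_in val_lt homeo_lt -val_lt -e1 -e2.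
- rewrite (extI_out f o2) e1 extI_in; have := unitI_itv y1; have := unitI_itv (f y1).
  rewrite e1 in x12; move: o2; rewrite negb_and -!ltNge => /orP[]; lra.
- rewrite (extI_out f o1) e2 extI_in; have := unitI_itv y2; have := unitI_itv (f y2).
  rewrite e2 in x12; move: o1; rewrite negb_and -!ltNge => /orP[]; lra.
- by rewrite !extI_out.
Qed.

Lemma extI_inj_id f : (forall x, extI f x = x) -> f = 1%g.
Proof. by move=> fx; apply: homeo_ext => y; apply: val_inj; rewrite -extI_in fx. Qed.

Lemma extI_rslope f y k : (y < unitI1)%O -> right_slopeI f y k ->
  rslope (extI f) (val y) k.
Proof.
move=> y1 [d d0 fk]; exists (Num.min d (1 - val y)).
  by rewrite lt_min d0 subr_gt0.
move=> t /andP[t0]; rewrite lt_min => /andP[td ty].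
have yt : 0 <= val y + t <= 1 by have := unitI_itv y; lra.
rewrite -{1}(val_clampI yt) !extI_in fk val_clampI //.
  by rewrite [X in k * X]addrC addKr.
by rewrite lerDl t0 ltrD2l.
Qed.

Lemma right_slopeI_of (F : R -> R) f y k : (forall z, val (f z) = F (val z)) ->
  rslope F (val y) k -> right_slopeI f y k.
Proof.
move=> fF [d d0 Fk]; exists d => // z /andP[yz zd].
rewrite !fF -Fk; first by rewrite addrC subrK.
by rewrite subr_ge0 yz ltrBlDl.
Qed.

Lemma extI_slope (H : pos_subgroup R) f x : loc_right_linearI H f ->
  exists2 k, H k & rslope (extI f) x k.
Proof.
move=> fH; have out : ~~ (0 <= x < 1) -> exists2 k, H k & rslope (extI f) x k.
  move=> xo; exists 1; first exact: pos_subgroup1.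
  have [x0|x0] := ltP x 0.
    by apply: rslope_fix x0 _ => t /andP[_ t0]; rewrite extI_out // negb_and -ltNge t0.
  have x1 : 1 <= x by rewrite leNgt; move: xo; rewrite x0.
  apply: (@rslope_fix _ _ _ (x + 1)) => [|t /andP[xt _]]; first by rewrite ltrDl.
  have [y e|?] := unitIP t; last exact: extI_out.
  have y1 : y = unitI1 by apply: val_inj; rewrite -e /=; have := unitI_itv y; lra.
  rewrite e extI_in y1; apply/le_anti; rewrite unitI_le1 /= -extI_in.
  have -> : val (unitI1 : unitI R) = 1 by [].
  rewrite leNgt; apply/negP => f1.
  (* an increasing bijection of the interval is onto at the right end *)
  have : ((((f^-1)%g : homeo (unitI R)) unitI1) <= unitI1)%O by exact: unitI_le1.
  rewrite -(homeo_le f) homeoVK -val_le -extI_in; move: f1.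
  by rewrite ltNge => /negP.
have [/andP[x0 x1]|] := boolP (0 <= x < 1); last exact: out.
have xy : val (clampI x) = x by rewrite val_clampI // x0 ltW.
have y1 : (clampI x < unitI1)%O by rewrite -val_lt xy.
have [k Hk fk] := fH _ y1; exists k => //.
by rewrite -xy; exact: extI_rslope.
Qed.

Lemma extI_action (H : pos_subgroup R) (K : subgroup (homeo (unitI R))) :
  (K : set _) `<=` loc_right_linearI H ->
  rl_action H (fun f : subgroup_type K => extI (sval f)).
Proof.
move=> KH; split.
- by move=> f g x; rewrite -extIM.
- by move=> f; exact: extI_le.
- by move=> f x; apply: extI_slope; apply: KH; apply: set_mem; exact: (svalP f).
- by move=> f; exists 0 => x x0; rewrite extI_out // negb_and -ltNge x0.
- by move=> f fx; apply: val_inj; exact: extI_inj_id.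
Qed.

(** A monotone bijection of the line is continuous, since its inverse turns order
intervals around a value into order intervals around the argument. *)
Lemma homeo_of_mono (F : R -> R) : {mono F : x y / x <= y} ->
  (forall r : R, exists x, F x = r) -> F 0 = 0 -> F 1 = 1 ->
  exists f, forall y, val (f y) = F (val y).
Proof.
move=> Fle Fsurj F0 F1.
have [V FV] := choice Fsurj.
have VF : cancel F V by move=> x; apply: (inc_inj Fle); rewrite FV.
have Vle : {mono V : x y / x <= y} by move=> a b; rewrite -Fle !FV.
have cont (P Q : R -> R) : {mono P : x y / x <= y} -> cancel P Q -> cancel Q P ->
    continuous P.
  move=> Ple PQ QP x; have Plt := leW_mono Ple.
  have Qlt a b : (Q a < b) = (a < P b) by rewrite -Plt QP.
  have Qgt a b : (b < Q a) = (P b < a) by rewrite -Plt QP.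
  apply/cvgrPdist_lt => e e0; near=> t.
  rewrite ltr_distlC; apply/andP; split.
    rewrite -Qlt; near: t; apply: lt_nbhsr.
    by rewrite Qlt ltrBlDr ltrDl.
  rewrite -Qgt; near: t; apply: lt_nbhsl.
  by rewrite Qgt ltrDl.
have mk (P : R -> R) : {mono P : x y / x <= y} -> continuous P -> P 0 = 0 -> P 1 = 1 ->
    exists p : unitI R -> unitI R, (forall y, val (p y) = P (val y)) /\ continuous p.
  move=> Ple Pc P0 P1; exists (fun y => clampI (P (val y))); split.
    move=> y; apply: val_clampI; have := Ple 0 (val y); have := Ple (val y) 1.
    by rewrite P0 P1 => -> ->; exact: unitI_itv.
  apply: to_unitI_continuous.
  have -> : val \o (fun y => clampI (P (val y))) =
      val \o clampI \o P \o (val : unitI R -> R) by [].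
  move=> y; apply: continuous_comp; first exact: val_continuous.
  apply: continuous_comp; first exact: Pc.
  apply: continuous_comp; first exact: clampI_continuous.
  exact: val_continuous.
have V0 : V 0 = 0 by rewrite -{1}F0 VF.
have V1 : V 1 = 1 by rewrite -{1}F1 VF.
have [p [pF pc]] := mk F Fle (cont _ _ Fle VF FV) F0 F1.
have [q [qV qc]] := mk V Vle (cont _ _ Vle FV VF) V0 V1.
have ph : is_incr_homeo p.
  split; first by move=> y z; rewrite -!val_lt !pF (leW_mono Fle).
  by exists q; split=> // y; apply: val_inj; [rewrite qV pF VF|rewrite pF qV FV].
by exists (exist _ p (asboolT ph)).
Unshelve. all: by end_near. Qed.

End UnitI.

(** * The actions of the six groups *)

Section LineAction.
Context {R : realType} (H : pos_subgroup R).
Implicit Types (f g : homeo (\bar R)) (x : R).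

Definition actE f x : R := fine (f x%:E).

Lemma actE_EFin f x : (actE f x)%:E = f x%:E.
Proof. by rewrite -homeoE_EFin. Qed.

Lemma actE_inj_id f : (forall x, actE f x = x) -> f = 1%g.
Proof.
move=> fx; apply: homeo_ext; rewrite -/(homeo_fun _).
have fixed r : f r%:E = r%:E by rewrite -actE_EFin fx.
case=> [r||]; first exact: fixed.
  case E : (f +oo%E) => [r||] //.
    by have := homeo_lt f (r%:E) +oo%E; rewrite E fixed ltxx ltry.
  by have := homeo_lt f (0%:E) +oo%E; rewrite E fixed ltry ltNge leNye.
case E : (f -oo%E) => [r||] //.
  by have := homeo_lt f -oo%E (r%:E); rewrite E fixed ltxx ltNyr.
by have := homeo_lt f -oo%E (0%:E); rewrite E fixed ltNyr ltNge leey.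
Qed.

Lemma actE_action (K : subgroup (homeo (\bar R))) :
  (K : set _) `<=` loc_right_linearE H `&` supp_bounded_below ->
  rl_action H (fun f : subgroup_type K => actE (sval f)).
Proof.
move=> KH; have KH' (f : subgroup_type K) := KH _ (set_mem (svalP f)).
split.
- by move=> f g x; rewrite /actE actE_EFin.
- by move=> f x y; rewrite -lee_fin !actE_EFin homeo_le lee_fin.
- move=> f x; have [k Hk [d d0 fk]] := (KH' f).1 x; exists k => //; exists d => // t td.
  by apply: EFin_inj; rewrite actE_EFin fk // EFinD actE_EFin.
- move=> f; have /supp_bounded_belowP[m fm] := (KH' f).2.
  by exists m => x xm; rewrite /actE fm // lte_fin.
- by move=> f fx; apply: val_inj; exact: actE_inj_id.
Qed.

End LineAction.

Lemma dlab_group_action (R : realType) (H : pos_subgroup R) (kd : dlab_kind) :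
  exists act : dlab_group H kd -> R -> R, rl_action H act.
Proof.
case: kd.
- by exists (fun f => extI (sval f)); apply: extI_action => f [].
- by exists (fun f => extI (sval f)); apply: extI_action => f [].
- by exists (fun f => extI (sval f)); apply: extI_action => f [].
- by exists (fun f => extI (sval f)); apply: extI_action => f.
- exists (fun f => actE (sval f)); apply: actE_action => f [fH fb]; split=> //.
  have /supp_boundedP[M fM] := fb; apply/supp_bounded_belowP; exists (- M) => y yM.
  by apply: fM; left.
- by exists (fun f => actE (sval f)); apply: actE_action => f [fH fb]; split.
Qed.

Section Dyadic.
Context {R : realType}.

Definition act2 (f : G2 R) : R -> R := extI (sval f).

Lemma G2P (f : G2 R) : [/\ loc_right_linearI (pow2 R) (sval f),
  id_near unitI0 (sval f) & id_near unitI1 (sval f)].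
Proof. by have /set_mem[? []] := svalP f. Qed.

Lemma mkG2 (f : homeo (unitI R)) : loc_right_linearI (pow2 R) f ->
  id_near unitI0 f -> id_near unitI1 f -> exists g : G2 R, sval g = f.
Proof.
move=> fl f0 f1.
have fD : f \in (D_I (pow2 R) : set (homeo (unitI R))) by apply/mem_set; split.
by exists (exist _ f fD).
Qed.

Lemma G2_full : full_dyadic_action act2.
Proof.
split.
- by apply: extI_action => f [].
- move=> f; have [_ f0 f1] := G2P f.
  have [e e0 fe] := unitI_nbhs f0; have [d d0 fd] := unitI_nbhs f1.
  pose c : R := Num.min (Num.min e d) 1 / 3.
  have c0 : 0 < Num.min (Num.min e d) 1 by rewrite !lt_min e0 d0 ltr01.
  have c1 : Num.min (Num.min e d) 1 <= 1 by rewrite ge_min lexx orbT.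
  have ce : Num.min (Num.min e d) 1 <= e by rewrite !ge_min lexx.
  have cd : Num.min (Num.min e d) 1 <= d by rewrite !ge_min lexx orbT.
  have v0 : val (unitI0 : unitI R) = 0 by [].
  have v1 : val (unitI1 : unitI R) = 1 by [].
  exists c, (1 - c); rewrite /c; split; try lra.
  move=> x xc; rewrite /act2; have [y e1|?] := unitIP x; last exact: extI_out.
  rewrite e1 extI_in; congr val; have y01 := unitI_itv y.
  rewrite e1 in xc; case: xc => xc; [apply: fe|apply: fd].
    by rewrite v0 distrC subr0 ger0_norm; lra.
  by rewrite v1 ger0_norm; lra.
- move=> F a b Frl a0 b1 Ffix.
  have [f fF] := homeo_of_mono (rl_le Frl) (rl_surj Frl) (Ffix 0 (or_introl (ltW a0)))
    (Ffix 1 (or_intror (ltW b1))).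
  have fext : extI f =1 F.
    move=> x; have [y ->|xo] := unitIP x; first by rewrite extI_in fF.
    rewrite extI_out // Ffix //; move: xo; rewrite negb_and -!ltNge => /orP[] ?.
      by left; lra.
    by right; lra.
  have [|||g gf] := @mkG2 f; last by exists g => x; rewrite /act2 gf.
  + move=> y _; have [k Hk Fk] := rl_slope Frl (val y); exists k => //.
    exact: right_slopeI_of Fk.
  + have : \forall y \near (unitI0 : unitI R), val y < a.
      exact: (@val_continuous R unitI0 _ (lt_nbhsl (a0 : val (unitI0 : unitI R) < a))).
    move=> near_a; apply: filterS near_a => y ya.
    by apply: val_inj; rewrite fF Ffix //; left; exact: ltW.
  + have : \forall y \near (unitI1 : unitI R), b < val y.
      exact: (@val_continuous R unitI1 _ (lt_nbhsr (b1 : b < val (unitI1 : unitI R)))).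
    move=> near_a; apply: filterS near_a => y ya.
    by apply: val_inj; rewrite fF Ffix //; right; exact: ltW.
Qed.

End Dyadic.

(** * Conjugation by a homeomorphism and the Dlab orders *)

Section Transport.
Context {R : realType}.
Implicit Types (f h psi : homeo (unitI R)) (y z : unitI R).

Lemma homeo_continuous f : continuous (f : unitI R -> unitI R).
Proof. by have [_ [g [_ _ fc _]]] := homeoP f. Qed.

Lemma image_component psi (A : set (unitI R)) y :
  psi @` connected_component A y `<=` connected_component (psi @` A) (psi y).
Proof.
have [Ay|nAy] := pselect (A y); last first.
  by rewrite (connected_component_out nAy) image_set0.
apply: connected_component_max.
- by exists y => //; exact: connected_component_refl.
- by apply: image_subset; exact: connected_component_sub.
- apply: connected_continuous_connected; first exact: component_connected.
  by apply: continuous_subspaceT; exact: homeo_continuous.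
Qed.

Lemma homeo_image psi (A : set (unitI R)) :
  psi @` A = ((psi^-1)%g : homeo (unitI R)) @^-1` A.
Proof.
apply/seteqP; split=> [_ [y Ay <-]|y Ay]; first by rewrite /preimage /mkset homeoK.
by exists ((psi^-1 : homeo (unitI R))%g y) => //; rewrite homeoVK.
Qed.

Lemma component_preimage psi (A : set (unitI R)) y :
  connected_component (psi @^-1` A) y = psi @^-1` connected_component A (psi y).
Proof.
have imV (B : set (unitI R)) : psi @` (psi @^-1` B) = B.
  by rewrite homeo_image -comp_preimage; apply/seteqP; split=> z /=; rewrite homeoVK.
apply/seteqP; split=> z /= Cz.
  rewrite -[A]imV; apply: image_component; by exists z.
have := @image_component (psi^-1)%g A (psi y).
rewrite homeo_image invgK homeoK => /(_ z); apply.
by exists (psi z) => //; rewrite homeoK.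
Qed.

Lemma supp_conj psi h : supp (psi^-1 * h * psi : homeo (unitI R))%g = psi @^-1` supp h.
Proof.
apply/seteqP; split=> y; rewrite /supp /preimage /mkset !homeoME => hy e; apply: hy.
  by rewrite e homeoK.
by rewrite -[in RHS]e homeoVK.
Qed.

Lemma first_breakpoint_conj psi h y : first_breakpoint h (psi y) ->
  first_breakpoint (psi^-1 * h * psi)%g y.
Proof.
move=> [C [[x hx CE] Cleft] [Clb Cub]].
exists (psi @^-1` C); [split|split].
- exists ((psi^-1 : homeo (unitI R))%g x).
    by rewrite supp_conj /preimage /mkset homeoVK.
  by rewrite supp_conj component_preimage homeoVK -CE.
- move=> _ [w hw ->]; rewrite supp_conj component_preimage in hw * => neq u v Cu Cv.
  rewrite -(homeo_lt psi).
  apply: (Cleft (connected_component (supp h) (psi w)) _ _ _ _ Cu Cv).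
    by exists (psi w) => //; rewrite supp_conj in hw.
  by move=> e; apply: neq; rewrite e.
- by move=> z Cz; rewrite -(homeo_le psi); exact: Clb.
- move=> b bC; rewrite -(homeo_le psi); apply: Cub => c Cc.
  rewrite -[c](homeoVK psi) homeo_le; apply: bC.
  by rewrite /preimage /mkset homeoVK.
Qed.

(** A monotone map does not carry [v] across a fixed point, so none lies between
the preimage and the image of [v]. *)
Lemma mono_displaced (F V : R -> R) v x : {mono F : x y / x <= y} ->
  cancel V F -> F v != v -> Num.min (V v) (F v) < x < Num.max (V v) (F v) -> F x != x.
Proof.
move=> Fle VF Fv; have Flt := leW_mono Fle.
have Vlt a : (V v < a) = (v < F a) by rewrite -Flt VF.
have Vgt a : (a < V v) = (F a < v) by rewrite -Flt VF.
have [vF|Fv'|e] := ltgtP v (F v); last by rewrite -e eqxx in Fv.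
  have Vv : V v < F v by rewrite Vlt (lt_trans vF) // Flt.
  rewrite (min_idPl (ltW Vv)) (max_idPr (ltW Vv)) Vlt => /andP[vFx xF].
  by apply/eqP => e; rewrite e in vFx; move: xF; rewrite -e Flt ltNge (ltW vFx).
have Vv : F v < V v by rewrite Vgt (lt_trans _ Fv') // Flt.
rewrite (min_idPr (ltW Vv)) (max_idPl (ltW Vv)) Vgt => /andP[Fvx Fxv].
by apply/eqP => e; rewrite e in Fxv; move: Fvx; rewrite -e Flt ltNge (ltW Fxv).
Qed.

(** If [h] moved [y], it would move a whole interval around [y]; being connected
and meeting the leftmost component, this interval would lie in it, against [y]
being its infimum. *)
Lemma first_breakpoint_fixed h y : first_breakpoint h y -> h y = y.
Proof.
move=> [C [[x hx CE] _] [Clb Cub]]; apply: contrapT => /eqP hy.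
have hVy : (h^-1 : homeo (unitI R))%g y != y.
  by apply/eqP => e; move/eqP: hy; apply; rewrite -{1}e homeoVK.
pose F := extI h; pose V := extI (h^-1)%g; pose v := val y.
have VF : cancel V F.
  move=> r; rewrite /V /F -extIM mulgV; have [w ->|ro] := unitIP r.
    by rewrite extI_in.
  exact: extI_out.
have FV : cancel F V.
  move=> r; rewrite /V /F -extIM mulVg; have [w ->|ro] := unitIP r.
    by rewrite extI_in.
  exact: extI_out.
have Fle : {mono F : x y / x <= y} := extI_le h.
have Flt := leW_mono Fle.
have Fv : F v != v by rewrite /F /v extI_in (inj_eq val_inj).
pose lo := Num.min (V v) (F v); pose hi := Num.max (V v) (F v).
have [lov vhi] : lo < v /\ v < hi.
  rewrite /lo /hi gt_min lt_max -(Flt (V v)) -(Flt v) VF.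
  by case: (ltgtP v (F v)) Fv => //= _; rewrite ?orbT.
have lohi01 : 0 <= lo /\ hi <= 1.
  rewrite /lo /hi /V /F /v !extI_in le_min ge_max !unitI_ge0 !unitI_le1; by [].
pose B : set (unitI R) := clampI @` `]lo, hi[.
have Bconn : connected B.
  apply: connected_continuous_connected.
    by apply/connected_intervalP; exact: interval_is_interval.
  by apply: continuous_subspaceT; exact: clampI_continuous.
have in01 r : lo < r -> r < hi -> 0 <= r <= 1.
  by move=> ? ?; case: lohi01; lra.
have Bsupp : B `<=` supp h.
  move=> _ [r /= + <-]; rewrite in_itv /= => /andP[lr rh].
  have r01 := in01 r lr rh; rewrite /supp /= => e.
  have : F r != r by apply: (mono_displaced Fle VF Fv); rewrite -/lo -/hi lr.
  by rewrite /F /extI r01 e val_clampI // eqxx.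
have [c Cc cB] : exists2 c, C c & B c.
  apply: contrapT => nBC; pose r := (v + hi) / 2.
  have [vr rhi] : v < r /\ r < hi by rewrite /r; split; lra.
  have r01 := in01 r (lt_trans lov vr) rhi.
  have : (clampI r <= y)%O.
    apply: Cub => c Cc; rewrite leNgt; apply/negP => cr; apply: nBC.
    exists c => //; exists (val c); last exact: clampIK.
    rewrite /= in_itv /=; apply/andP; split.
      by apply: lt_le_trans lov _; exact: Clb.
    by apply: lt_trans rhi; rewrite -(val_clampI r01).
  by rewrite -val_le val_clampI // leNgt vr.
have BC : B `<=` C.
  rewrite CE in Cc *; rewrite (same_connected_component Cc).
  exact: connected_component_max.
pose r := (lo + v) / 2; have [lor rv] : lo < r /\ r < v by rewrite /r; split; lra.
have r01 := in01 r lor (lt_trans rv vhi).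
have : (y <= clampI r)%O.
  apply: Clb; apply: BC; exists r => //; rewrite /= in_itv /= lor /=.
  exact: lt_trans vhi.
by rewrite -val_le val_clampI // leNgt rv.
Qed.

Lemma first_breakpoint_lt1 h y : first_breakpoint h y -> (y < unitI1)%O.
Proof.
move=> [C [[x hx CE] _] [Clb _]].
have Cx : C x by rewrite CE; exact: connected_component_refl.
apply: le_lt_trans (Clb _ Cx) _; rewrite lt_neqAle [X in _ && X]unitI_le1 andbT.
apply/eqP => x1; apply: hx; rewrite x1; apply/le_anti/andP.
split; first exact: unitI_le1.
by rewrite -{1}(homeoVK h unitI1) homeo_le; exact: unitI_le1.
Qed.

(** The first breakpoint [a] is fixed by [h], so the slopes of [psi] and of its
inverse that enter the chain rule are taken at the same point and cancel. *)
Lemma dlab_pos_conj up psi h :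
  (forall y, exists2 s : R, 0 < s & right_slopeI psi y s) ->
  dlab_pos up h -> dlab_pos up (psi^-1 * h * psi)%g.
Proof.
move=> psis [a [k [ha hk kup]]].
pose y : unitI R := (psi^-1 : homeo (unitI R))%g a.
have psiy : psi y = a by rewrite /y homeoVK.
have haa := first_breakpoint_fixed ha.
have k0 : 0 < k.
  have [d d0 hd] := extI_rslope (first_breakpoint_lt1 ha) hk.
  have : extI h (val a) < extI h (val a + d / 2).
    by rewrite (leW_mono (extI_le h)) ltrDl divr_gt0.
  rewrite hd; last by apply/andP; split; lra.
  by rewrite ltrDl pmulr_lgt0 // divr_gt0.
have [s s0 ps] := psis y; have psV := right_slopeIV s0 ps.
exists y, k; split=> //.
  by apply: first_breakpoint_conj; rewrite psiy.
have -> : k = s^-1 * k * s by rewrite mulrAC mulVf ?mul1r // lt0r_neq0.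
apply: right_slopeIM ps => //; rewrite psiy; apply: right_slopeIM hk => //.
by rewrite haa -psiy.
Qed.

(** The slopes of [psi] range over one coset of the powers of 2, so that the two
contributions of [psi] to a slope of the conjugate cancel up to a power of 2. *)
Lemma conj_in_G2 (K : R -> Prop) psi (f : G2 R) :
  (forall s, K s -> 0 < s) -> (forall s t, K s -> K t -> pow2 R (s^-1 * t)) ->
  (forall y, exists2 s, K s & right_slopeI psi y s) ->
  exists g : G2 R, sval g = (psi^-1 * sval f * psi)%g.
Proof.
move=> K0 Kpow psis; have [] := G2P f.
move: (sval f : homeo (unitI R)) => h fl f0 f1.
have fixed_near y : psi y = y -> id_near y (h) ->
    id_near y (psi^-1 * h * psi : homeo (unitI R))%g.
  move=> py fy; have fpy : nbhs (psi y) [set w | h w = w] by rewrite py.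
  have {}fpy : nbhs y [set z | h (psi z) = psi z] := homeo_continuous fpy.
  by apply: filterS fpy => z fz; rewrite !homeoME fz homeoK.
apply: mkG2.
- move=> y y1; have [s Ks ps] := psis y.
  have [k Hk fk] := fl _ (homeoI_lt1 psi y1).
  pose z : unitI R := (psi^-1 : homeo (unitI R))%g (h (psi y)).
  have [t Kt pt] := psis z.
  exists (t^-1 * k * s).
    by rewrite mulrAC; apply: pow2_M Hk; exact: Kpow.
  apply: right_slopeIM ps; first exact: K0.
  apply: right_slopeIM fk; first exact: pow2_gt0 Hk.
  rewrite -[h (psi y)](homeoVK psi); apply: right_slopeIV pt; exact: K0.
- apply: fixed_near f0; apply/le_anti/andP; split; last exact: unitI_ge0.
  rewrite -[leRHS](homeoVK psi) homeo_le; exact: unitI_ge0.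
- apply: fixed_near f1; apply/le_anti/andP; split; first exact: unitI_le1.
  rewrite -[leLHS](homeoVK psi) homeo_le; exact: unitI_le1.
Qed.

(** Slope 3/4, then 3/2 on [1/3, 2/3], then 3/4 again; the pieces are placed so
that 0, 1/2 and 1 are fixed. *)
Definition phi_fun x : R :=
  Num.min (Num.max (3 / 2 * x + - (1 / 4)) (3 / 4 * x + 0)) (3 / 4 * x + 1 / 4).

Definition phi_slope (s : R) : Prop := s = 3 / 4 \/ s = 3 / 2.

Lemma phi_fun_rl : rl_map phi_slope phi_fun.
Proof.
have K1 : phi_slope (3 / 4) by left.
have K2 : phi_slope (3 / 2) by right.
by apply: rl_min; [apply: rl_max|]; apply: rl_affine => //; lra.
Qed.

Lemma phi_slope_gt0 s : phi_slope s -> 0 < s.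
Proof. by case=> ->; lra. Qed.

Lemma phi_slope_pow2 s t : phi_slope s -> phi_slope t -> pow2 R (s^-1 * t).
Proof.
have p2 : pow2 R 2 by exists 1.
have h1 : (3 / 4)^-1 * (3 / 4) = 1 :> R by field.
have h2 : (3 / 2)^-1 * (3 / 2) = 1 :> R by field.
have h3 : (3 / 4)^-1 * (3 / 2) = 2 :> R by field.
have h4 : (3 / 2)^-1 * (3 / 4) = 2^-1 :> R by field.
case=> -> [] ->; rewrite ?h1 ?h2 ?h3 ?h4 //; try exact: pow2_1.
exact: pow2_V.
Qed.

Lemma phi_exists : exists phi : homeo (unitI R),
  [/\ forall y, exists2 s, phi_slope s & right_slopeI phi y s,
      extI phi (1 / 2) = 1 / 2 & rslope (extI phi) (1 / 2) (3 / 2)].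
Proof.
have f0 : phi_fun 0 = 0.
  rewrite /phi_fun (max_idPr _) ?(min_idPl _); lra.
have f1 : phi_fun 1 = 1.
  rewrite /phi_fun (max_idPl _) ?(min_idPr _); lra.
have fh t : 0 <= t < 1 / 12 -> phi_fun (1 / 2 + t) = 1 / 2 + 3 / 2 * t.
  move=> /andP[t0 t1]; rewrite /phi_fun (max_idPl _) ?(min_idPl _); lra.
have [phi phiE] := homeo_of_mono (rl_le phi_fun_rl) (rl_surj phi_fun_rl) f0 f1.
have ext x : 0 <= x <= 1 -> extI phi x = phi_fun x.
  by move=> x01; rewrite /extI x01 phiE val_clampI.
have e2 : extI phi (1 / 2) = 1 / 2.
  rewrite ext; last by apply/andP; split; lra.
  by rewrite -[X in phi_fun X]addr0 fh ?mulr0 ?addr0 // lexx /=; lra.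
exists phi; split=> //.
- move=> y; have [s Ks fs] := rl_slope phi_fun_rl (val y).
  by exists s => //; exact: right_slopeI_of fs.
- exists (1 / 12); first lra.
  move=> t t1; rewrite e2 ext ?fh //; move/andP: t1 => [? ?].
  by apply/andP; split; lra.
Qed.

End Transport.

Theorem theorem1p1 (R : realType) (up : bool) :
  exists2 alpha : G2 R -> G2 R,
    order_automorphism (@dlab_le R up) alpha &
    forall (H : pos_subgroup R), rank_one H ->
    forall (kd : dlab_kind) (leA : rel (dlab_group H kd)), linear_order leA ->
    forall e : G2 R -> dlab_group H kd,
      order_embedding (@dlab_le R up) leA e ->
    forall u : dlab_group H kd,
    exists f : G2 R, e (alpha f) <> (u^-1 * e f * u)%g.
Proof.
have [phi [phis phi2 phi2s]] := phi_exists (R := R).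
have phiVs y : exists2 s, phi_slope s^-1 & right_slopeI (phi^-1)%g y s.
  have [s Ks ps] := phis ((phi^-1 : homeo (unitI R))%g y).
  exists s^-1; first by rewrite invrK.
  by rewrite -{1}(homeoVK phi y); apply: right_slopeIV ps; exact: phi_slope_gt0.
have [alpha alphaE] := choice (fun f => conj_in_G2 f phi_slope_gt0 phi_slope_pow2 phis).
have VK0 (s : R) : phi_slope s^-1 -> 0 < s.
  by move=> /phi_slope_gt0; rewrite invr_gt0.
have VKpow (s t : R) : phi_slope s^-1 -> phi_slope t^-1 -> pow2 R (s^-1 * t).
  by move=> Ks Kt; rewrite mulrC -[t]invrK; exact: phi_slope_pow2.
have [beta betaE] := choice (fun f => conj_in_G2 f VK0 VKpow phiVs).
have alphaK : cancel alpha beta.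
  by move=> f; apply: val_inj; rewrite /= betaE alphaE invgK !mulgA mulgV mul1g mulgK.
have betaK : cancel beta alpha.
  by move=> f; apply: val_inj; rewrite /= alphaE betaE invgK !mulgA mulVg mul1g mulgVK.
have alphaM : {morph alpha : f g / (f * g)%g}.
  move=> f g; apply: val_inj; rewrite /= [LHS]alphaE.
  change ((phi^-1 * (sval f * sval g) * phi)%g = (sval (alpha f) * sval (alpha g))%g).
  by rewrite !alphaE !mulgA mulgK.
exists alpha.
  split=> //; first by exists beta.
  move=> f g; rewrite /dlab_le (can_eq alphaK); congr (_ || _).
  have -> : ((alpha f)^-1 * alpha g)%g = alpha (f^-1 * g)%g.
    by apply: (@mulgI _ (alpha f)); rewrite mulgA mulgV mul1g -alphaM mulgA mulgV mul1g.
  set h := (f^-1 * g)%g; apply: asbool_equiv_eq; split.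
    move=> ah; rewrite -(alphaK h) betaE; apply: dlab_pos_conj ah => y.
    by have [s /VK0 s0 ps] := phiVs y; exists s.
  move=> hp; rewrite alphaE; apply: dlab_pos_conj hp => y.
  by have [s /phi_slope_gt0 s0 ps] := phis y; exists s.
move=> H Hrank kd leA _ e [eM einj _] u.
have [act Pact] := dlab_group_action H kd.
apply: contrapT => noconj.
have conj f : e (alpha f) = (u^-1 * e f * u)%g.
  by apply: contrapT => ne; apply: noconj; exists f.
have e1 : e 1%g = 1%g by apply: (@mulgI _ (e 1%g)); rewrite -eM !mulg1.
have PE : rl_action H (fun f => act (e f)).
  split.
  - by move=> f g x; rewrite eM (actM Pact).
  - by move=> f; exact: (act_le Pact).
  - by move=> f x; exact: (act_slope Pact).
  - by move=> f; exact: (act_below Pact).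
  - by move=> f /(act_faithful Pact) ef; apply: einj; rewrite ef e1.
apply: (@no_rank_one_conjugation R (G2 R) act2 (G2_full) H _ PE alpha
          (extI phi) (act u)) => //.
- by move=> f; exists (beta f).
- exact: extI_le.
- move=> y; exists (extI (phi^-1)%g y); rewrite -extIM mulgV.
  by have [z ->|yo] := unitIP y; rewrite ?extI_in ?extI_out.
- split; [exact: (act_le Pact)| |exact: (act_slope Pact)].
  by move=> y; exists (act u^-1%g y); rewrite (actVK Pact).
- by move=> f x; rewrite /act2 alphaE -!extIM !mulgA mulgV mul1g.
- by move=> f x; rewrite -!(actM Pact) conj !mulgA mulgV mul1g.
Qed.
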